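(* Suppose the noise $\varepsilon$ is normal with mean $0$ and variance $0<\sigma^2<\infty$. For $\mathcal{F}=\mathcal{F}_q(t_n;M_n)$ with $0<q\le1$, or $\mathcal{F}=\mathcal{F}_0(k_n;M_n)$ with $1\le k_n\le M_n$, or $\mathcal{F}=\mathcal{F}_q(t_n;M_n)\cap\mathcal{F}_0(k_n;M_n)$ with $0<q\le1$ and $1\le k_n\le M_n$, under Assumption SRC$'$ with $\gamma=m_*$, or $\gamma=k_n$, or $\gamma=k_n\wedge m_*$, respectively, we have $$\inf_{\hat f}\sup_{f_0\in\mathcal{F}}E(ASE(\hat f))\ge B'\,\underline\Phi^{\mathcal{F}},$$ where $\hat f$ ranges over all estimators, and the (positive) constant $B'$ depends only on $\underline a$ and $\overline a$ for the second case of $\mathcal{F}$ and additionally on $q$ for the first and third cases of $\mathcal{F}$.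
   Context: FIXED DESIGN. $n\ge2$, $M_n\ge2$. $Y_i=f_0(\mathbf{x}_i)+\varepsilon_i$, $i=1,\ldots,n$, with fixed $\mathbf{x}_i=(x_{i,1},\ldots,x_{i,M_n})'\in\mathbb{R}^{M_n}$, i.i.d. errors, and $\max_{1\le j\le M_n}\sum_{i=1}^nx_{i,j}^2/n\le1$. $\|f\|_n^2=\frac1n\sum_if^2(\mathbf{x}_i)$, $ASE(\hat f)=\|\hat f-f_0\|_n^2$. $f_\theta(\mathbf{x})=\sum_j\theta_jx_j$, $\|\theta\|_0$ is the number of nonzero components, $\|\theta\|_q=(\sum|\theta_j|^q)^{1/q}$; $\mathcal{F}_q(t_n;M_n)=\{f_\theta:\|\theta\|_q\le t_n\}$ ($t_n>0$), $\mathcal{F}_0(k_n;M_n)=\{f_\theta:\|\theta\|_0\le k_n\}$. $\Xi$ is the $n\times M_n$ design matrix with rank $r_{M_n}\ge1$. Assumption SRC$'$ (with parameter $\gamma>0$): there exist two positive constants $\underline a$ and $\overline a$ not depending on $n$ such that for every $\theta$ with $\|\theta\|_0\le\min(2\gamma,M_n)$, $\underline a\|\theta\|_2\le\frac1{\sqrt n}\|\Xi\theta\|_2\le\overline a\|\theta\|_2$. $\tau=\sigma^{-2}$; $m^*=\lceil(nt_n^2\tau)^{q/2}\rceil\wedge M_n\wedge n$; $m_*=m^*$ if $m^*=M_n\wedge n$, otherwise $m_*=\lceil m^*/(1+\log(M_n/m^* ))^{q/2}\rceil$. $$\underline\Phi^{\mathcal{F}_q(t_n;M_n)}=\begin{cases}\frac{\sigma^2r_{M_n}}{n}&\text{if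 }m_*=M_n\wedge n,\\ \sigma^{2-q}t_n^q\Bigl(\frac{1+\log\frac{M_n}{(nt_n^2\tau)^{q/2}}}{n}\Bigr)^{1-q/2}\wedge\frac{\sigma^2r_{M_n}}{n}&\text{if }1<m_*<M_n\wedge n,\\ t_n^2\wedge\frac{\sigma^2r_{M_n}}{n}&\text{if }m_*=1,\end{cases}$$ $\underline\Phi^{\mathcal{F}_0(k_n;M_n)}=\frac{\sigma^2k_n(1+\log(M_n/k_n))}{n}\wedge\frac{\sigma^2r_{M_n}}{n}$, $\underline\Phi^{\mathcal{F}_q(t_n;M_n)\cap\mathcal{F}_0(k_n;M_n)}=\underline\Phi^{\mathcal{F}_q(t_n;M_n)}\wedge\underline\Phi^{\mathcal{F}_0(k_n;M_n)}$. *)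

(* Defs.v *)
From HB Require Import structures.
From mathcomp Require Import all_boot all_order all_algebra.
From mathcomp Require Import all_classical all_reals all_analysis.

Set Implicit Arguments.
Unset Strict Implicit.
Unset Printing Implicit Defensive.

Import Order.TTheory GRing.Theory Num.Theory.
Import numFieldNormedType.Exports.

Local Open Scope classical_set_scope.
Local Open Scope ring_scope.

Section Vectors.
Context {R : realType}.

Definition l0norm {m} (v : 'cV[R]_m) : nat := #|[pred i | v i 0 != 0]|.

Definition lqnorm {m} (q : R) (v : 'cV[R]_m) : R :=
  (\sum_(i < m) `|v i 0| `^ q) `^ q^-1.

Definition lin_fct {M} (theta x : 'cV[R]_M) : R :=
  \sum_(j < M) theta j 0 * x j 0.

Definition lq_hull M (q t : R) : set ('cV[R]_M -> R) :=
  [set lin_fct theta | theta in [set theta | lqnorm q theta <= t]].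

Definition l0_hull M (k : nat) : set ('cV[R]_M -> R) :=
  [set lin_fct theta | theta in [set theta | (l0norm theta <= k)%N]].

End Vectors.

Arguments lq_hull {R} M q t _.
Arguments l0_hull {R} M k _.

Section Design.
Context {R : realType} {n M : nat}.
Variable X : 'M[R]_(n, M).

Definition design_point (i : 'I_n) : 'cV[R]_M := (row i X)^T.

Definition normalized_design : Prop :=
  forall j : 'I_M, (\sum_(i < n) X i j ^+ 2) / n%:R <= 1.

Definition sq_normn (f : 'cV[R]_M -> R) : R :=
  n%:R^-1 * \sum_(i < n) f (design_point i) ^+ 2.

Definition ASE (f0 fhat : 'cV[R]_M -> R) : R :=
  sq_normn (fun x => fhat x - f0 x).

Definition SRC' (gamma alow aup : R) : Prop :=
  forall theta : 'cV[R]_M,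
    (l0norm theta)%:R <= Num.min (2 * gamma) M%:R ->
    alow * lqnorm 2 theta <= (Num.sqrt n%:R)^-1 * lqnorm 2 (X *m theta) /\
    (Num.sqrt n%:R)^-1 * lqnorm 2 (X *m theta) <= aup * lqnorm 2 theta.

End Design.

Section Noise.
Context {R : realType} {d : measure_display} {T : measurableType d}.
Variable P : probability T R.

Definition mutually_independent {n} (eps : 'I_n -> {RV P >-> R}) : Prop :=
  forall (J : {set 'I_n}) (A : 'I_n -> set R),
    (forall i, measurable (A i)) ->
    P (\bigcap_(i in [set` J]) (eps i @^-1` A i)) =
    (\prod_(i in J) P (eps i @^-1` A i))%E.

(* The two laws are compared on measurable sets only, since the values of a
   measure on the other sets are arbitrary. *)
Definition iid_gaussian {n} (sigma : R) (eps : 'I_n -> {RV P >-> R}) : Prop :=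
  mutually_independent eps /\
  forall (i : 'I_n) (A : set R), measurable A ->
    distribution P (eps i) A = normal_prob 0 sigma A.

Definition response {n M} (X : 'M[R]_(n, M)) (f0 : 'cV[R]_M -> R)
    (eps : 'I_n -> {RV P >-> R}) (w : T) : n.-tuple R :=
  [tuple f0 (design_point X i) + eps i w | i < n].

(* Borel measurability in the data, with the product sigma-algebra on R^n. *)
Definition is_estimator {n M} (fhat : n.-tuple R -> 'cV[R]_M -> R) : Prop :=
  forall x : 'cV[R]_M, measurable_fun [set: n.-tuple R] (fun y => fhat y x).

Definition minimax_risk {n M} (X : 'M[R]_(n, M)) (eps : 'I_n -> {RV P >-> R})
    (F : set ('cV[R]_M -> R)) : \bar R :=
  ereal_inf
    [set ereal_sup
       [set ('E_P[fun w => ASE X f0 (fhat (response X f0 eps w))])%E | f0 in F]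
     | fhat in [set fhat | is_estimator fhat]].

End Noise.

Section Rates.
Context {R : realType}.

(* sigma is the standard deviation, so that tau = sigma ^- 2; the argument of
   Num.ceil is nonnegative, so that `| _ |%N only casts the ceiling to nat. *)
Definition eff_upper (n M : nat) (sigma q t : R) : nat :=
  minn (minn `|Num.ceil ((n%:R * t ^+ 2 * sigma ^- 2) `^ (q / 2))|%N M) n.

Definition eff_lower (n M : nat) (sigma q t : R) : nat :=
  let m := eff_upper n M sigma q t in
  if m == minn M n then m
  else `|Num.ceil (m%:R / (1 + ln (M%:R / m%:R)) `^ (q / 2))|%N.

Definition rate_lq (n M r : nat) (sigma q t : R) : R :=
  let m := eff_lower n M sigma q t in
  let full := sigma ^+ 2 * r%:R / n%:R in
  if m == minn M n then full
  else if (1 < m)%N then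
    Num.min
      (sigma `^ (2 - q) * t `^ q *
       ((1 + ln (M%:R / (n%:R * t ^+ 2 * sigma ^- 2) `^ (q / 2))) / n%:R)
         `^ (1 - q / 2))
      full
  else Num.min (t ^+ 2) full.

Definition rate_l0 (n M r : nat) (sigma : R) (k : nat) : R :=
  Num.min (sigma ^+ 2 * k%:R * (1 + ln (M%:R / k%:R)) / n%:R)
          (sigma ^+ 2 * r%:R / n%:R).

Definition rate_lq_l0 (n M r : nat) (sigma q t : R) (k : nat) : R :=
  Num.min (rate_lq n M r sigma q t) (rate_l0 n M r sigma k).

End Rates.

(* Main.v *)
Require Import Defs.
From HB Require Import structures.
From mathcomp Require Import all_boot all_order all_algebra.
From mathcomp Require Import all_classical all_reals all_analysis.
From mathcomp Require Import measurable_realfun ring lra.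

(** Write theta_0 for the unknown coefficient vector and let m = X theta_0 be
    the mean of the data.  The lower bounds come from one family of difficult
    vectors.  Take k disjoint blocks of s = M %/ k coordinates, and let theta_J
    carry the value lambda at one coordinate of each block, or at none, as
    prescribed by J : block -> option coordinate.  These vectors are k-sparse
    with nonzero entries equal to lambda, so theta_J lies in the l_0 ball, and
    in the l_q ball as soon as lambda * k^(1/q) <= t.

    Separation.  A difference of two such vectors has at most 2k nonzero
    entries, so the lower restricted isometry bound turns the number of blocks
    on which J and J' disagree into a lower bound for the distance of their
    means ([block_vector_separated], [SRC'_lower]).  Hence an estimator of the
    mean yields, by moving to the nearest X theta_J, a decision on each block,
    and its squared error is at least a multiple of lambda^2 times the number
    of blocks decided wrongly ([assouad_risk]).

    Indistinguishability.  With the other blocks fixed, deciding one block is a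
    test among N = s + 1 Gaussian laws whose means are within
    lambda * sqrt n of a common point, because the columns of X are normalized.
    By the Cameron-Martin formula ([cameron_martin]) each law has a likelihood
    ratio L with E L^2 = exp (|v|^2 / sigma^2) with respect to the common one
    ([integral_likelihood_sq]).  If n lambda^2 <= sigma^2 ln N / 2, these second
    moments are at most sqrt N, and no test is right with average probability
    above 7/8 ([testing_bound]).

    Together, for every lambda with lambda^2 <= sigma^2 ln N / (2 n), the
    minimax risk is at least alow^2 lambda^2 k / 32 ([block_risk]); moreover
    ln N is comparable to 1 + ln (M / k) ([ln_block_size]).  For the l_0 ball
    the largest admissible lambda gives the rate at once.  For the intersection
    with an l_q ball one uses min (k, m) blocks, m = m_* being the effective
    sparsity, and the largest lambda compatible with both constraints; it
    remains to compare the two terms of this minimum with the rate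
    ([rate_le_radius], [rate_le_dimension]).  The l_q ball alone is the
    intersection with the l_0 ball of size M. *)

Set Implicit Arguments.
Unset Strict Implicit.
Unset Printing Implicit Defensive.

Import Order.TTheory GRing.Theory Num.Theory.
Import numFieldNormedType.Exports.

Local Open Scope classical_set_scope.
Local Open Scope ring_scope.

(** * Measures with a density *)

Section density_measure.
Local Open Scope ereal_scope.
Context d (T : measurableType d) (R : realType).
Variables (mu : {measure set T -> \bar R}) (g : T -> R).

(** The proofs are arguments so that the measure structure can be inferred
    from the term. *)
Definition density_measure (mg : measurable_fun setT g)
  (g0 : forall x, (0 <= g x)%R) (A : set T) : \bar R :=
  \int[mu]_(x in A) (g x)%:E.

Variables (mg : measurable_fun setT g) (g0 : forall x, (0 <= g x)%R).
Local Notation nu := (density_measure mg g0).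

Let density0 : nu set0 = 0.
Proof. by rewrite /density_measure integral_set0. Qed.

Let density_ge0 A : 0 <= nu A.
Proof. by apply: integral_ge0 => x _; rewrite lee_fin. Qed.

Let density_sigma_additive : semi_sigma_additive nu.
Proof.
move=> /= F mF tF mUF; rewrite /density_measure; apply: cvg_toP.
  apply: ereal_nondecreasing_is_cvgn => m n mn.
  apply: lee_sum_nneg_natr => // k _ _.
  by apply: integral_ge0 => x _; rewrite lee_fin.
rewrite ge0_integral_bigcup//=.
  exact/measurable_EFinP/measurable_funTS.
by move=> x _; rewrite lee_fin.
Qed.

HB.instance Definition _ := isMeasure.Build _ _ _
  nu density0 density_ge0 density_sigma_additive.

Import HBNNSimple.

Let integral_density_nnsfun (f : {nnsfun T >-> R}) :
  \int[nu]_x (f x)%:E = \int[mu]_x ((g x)%:E * (f x)%:E).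
Proof.
under [LHS]eq_integral do rewrite fimfunE -fsumEFin//.
rewrite [LHS]ge0_integral_fsum//; last 2 first.
  - by move=> r; exact/measurable_EFinP/measurableT_comp.
  - by move=> n x _; rewrite EFinM nnfun_muleindic_ge0.
under [RHS]eq_integral.
  move=> x xD; rewrite fimfunE -fsumEFin// ge0_mule_fsumr; last first.
    by move=> r; rewrite EFinM nnfun_muleindic_ge0.
  over.
rewrite [RHS]ge0_integral_fsum//; last 2 first.
  - move=> r; apply: emeasurable_funM => //; first exact/measurable_EFinP.
    exact/measurable_EFinP/measurableT_comp.
  - by move=> n x _; rewrite mule_ge0 ?lee_fin// -lee_fin EFinM nnfun_muleindic_ge0.
apply: eq_fsbigr => r _.
rewrite integralZl_indic_nnsfun//= integral_indic// setIT.
under [RHS]eq_integral do rewrite EFinM muleCA.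
have [fr0|fr0] := eqVneq (f @^-1` [set r]) set0.
  rewrite fr0 measure0 mule0 integral0_eq// => x _.
  by rewrite indic0/= !mule0.
have r0 : (0 <= r)%R by case/set0P: fr0 => x /= <-.
rewrite ge0_integralZl//; last 2 first.
  - apply: emeasurable_funM => //; apply/measurable_EFinP => //.
  - by move=> x _; rewrite mule_ge0// lee_fin.
congr (_ * _); rewrite [LHS]integral_mkcond.
apply: eq_integral => x _; rewrite patchE indicE.
by case: ifPn; rewrite ?mule1 ?mule0.
Qed.

(** The identity is linear in [f] and holds for indicators by definition of the
    measure; simple functions and monotone convergence do the rest. *)
Lemma ge0_integral_density (f : T -> \bar R) :
  measurable_fun setT f -> (forall x, 0 <= f x) ->
  \int[nu]_x f x = \int[mu]_x ((g x)%:E * f x).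
Proof.
move=> mf f0; pose f_ := nnsfun_approx measurableT mf.
transitivity (lim (\int[nu]_x (f_ n x)%:E @[n --> \oo])).
  rewrite -monotone_convergence//=.
  - apply: eq_integral => ? /[!inE] xD; apply/esym/cvg_lim => //=.
    exact: cvg_nnsfun_approx.
  - by move=> n; exact/measurable_EFinP/measurable_funTS.
  - by move=> n ? _; rewrite lee_fin.
  - by move=> ? _ ? ? mn; rewrite lee_fin; exact/lefP/nd_nnsfun_approx.
under eq_fun do rewrite integral_density_nnsfun.
rewrite -monotone_convergence//=.
- apply: eq_integral => x _; apply/cvg_lim => //.
  by apply: cvgeZl => //; exact: cvg_nnsfun_approx.
- by move=> n; apply: emeasurable_funM => //; exact/measurable_EFinP.
- by move=> n x _; rewrite mule_ge0// lee_fin.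
- move=> x _ m n mn; rewrite lee_wpmul2l ?lee_fin//.
  exact/lefP/nd_nnsfun_approx.
Qed.

End density_measure.

(** The pushforward, with the proof of measurability kept in the term: this makes
    it a measure without further inference. *)
Definition image_measure d d' (T : measurableType d) (T' : measurableType d')
    (R : realType) (mu : {measure set T -> \bar R}) (f : T -> T')
    (mf : measurable_fun setT f) : {measure set T' -> \bar R}.
Proof. by unshelve refine (pushforward mu f : {measure set T' -> \bar R}). Defined.

Lemma ge0_integral_image d d' (T : measurableType d) (T' : measurableType d')
    (R : realType) (mu : {measure set T -> \bar R}) (f : T -> T')
    (mf : measurable_fun setT f) (h : T' -> \bar R) :
  measurable_fun setT h -> (forall x, 0 <= h x)%E ->
  (\int[image_measure mu mf]_x h x = \int[mu]_x h (f x))%E.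
Proof. by move=> mh h0; rewrite ge0_integral_pushforward. Qed.

(** * Translating a centred Gaussian *)

Section gaussian_shift.
Context {R : realType}.

Definition translate (v x : R) : R := v + x.

Lemma measurable_translate v : measurable_fun setT (translate v).
Proof. exact: measurable_funD. Qed.

(** Lebesgue measure is determined by its values on half-open intervals, whose
    lengths are translation invariant. *)
Lemma lebesgue_measure_translate (v : R) (A : set R) : measurable A ->
  lebesgue_measure A = lebesgue_measure (translate v @^-1` A).
Proof.
move=> mA; refine (lebesgue_measure_unique (mu := image_measure
  (T := measurableTypeR R) (T' := measurableTypeR R) lebesgue_measure
  (measurable_translate v)) _ mA) => X [[a b] _ <-]; rewrite /pushforward /=.
rewrite /image_measure /pushforward /=.
rewrite (_ : _ @^-1` _ = `]a - v, b - v]%classic); last first.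
  by apply/seteqP; split=> x /=; rewrite !in_itv/= /translate ltrBlDl lerBrDl.
rewrite !lebesgue_measure_itv/= !lte_fin ltrD2r.
by case: ifPn => // _; rewrite -!EFinD; congr EFin; ring.
Qed.

(** The density of the normal law N(v, s^2) with respect to N(0, s^2). *)
Definition shift_density (s v x : R) : R :=
  expR ((v * x - v ^+ 2 / 2) / s ^+ 2).

Lemma measurable_shift_density s v : measurable_fun setT (shift_density s v).
Proof.
apply: measurableT_comp => //; apply: measurable_funM => //.
by apply: measurable_funB => //; exact: measurable_funM.
Qed.

Lemma shift_density_ge0 s v x : 0 <= shift_density s v x.
Proof. exact: expR_ge0. Qed.

Lemma normal_pdf_translate (s v x : R) : s != 0 ->
  normal_pdf 0 s (x - v) = normal_pdf 0 s x * shift_density s v x.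
Proof.
move=> s0; rewrite normal_pdfE// /normal_fun /shift_density -mulrA -expRD.
by congr (_ * expR _); field.
Qed.

(** Under N(0, s^2), the law of [v + x] has density [shift_density s v]: translate
    the Lebesgue integral, then compare the two normal densities. *)
Lemma normal_prob_translate (s v : R) (A : set R) : 0 < s -> measurable A ->
  normal_prob 0 s (translate v @^-1` A) =
  (\int[normal_prob 0 s]_x ((shift_density s v x)%:E * (\1_A x)%:E))%E.
Proof.
move=> s0 mA; have sn0 : s != 0 by rewrite gt_eqF.
have mpdf := measurable_normal_pdf 0 s.
have pdf0 := normal_pdf_ge0 0 s.
have mL := measurable_shift_density s v.
(* [normal_prob] is by definition a measure with a density. *)
rewrite (_ : (\int[_]_x _ = \int[density_measure lebesgue_measure mpdf pdf0]_x
   ((shift_density s v x)%:E * (\1_A x)%:E))%E); last first.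
  by apply: eq_measure_integral.
rewrite ge0_integral_density; last 2 first.
- by apply: emeasurable_funM; apply/measurable_EFinP.
- by move=> x; rewrite -EFinM lee_fin mulr_ge0 ?shift_density_ge0.
rewrite /normal_prob [in LHS]integral_mkcond.
pose F y : \bar R := (normal_pdf 0 s (y - v) * \1_A y)%:E.
have mF : measurable_fun setT F.
  apply/measurable_EFinP; apply: measurable_funM => //.
  by apply: measurableT_comp => //; exact: measurable_funB.
transitivity (\int[lebesgue_measure]_x F (translate v x))%E.
  apply: eq_integral => x _; rewrite patchE /F indicE.
  have -> : translate v x - v = x by rewrite /translate; ring.
  have -> : (x \in translate v @^-1` A) = (translate v x \in A) by [].
  by case: ifPn; rewrite ?mulr1 ?mulr0.
rewrite -(ge0_integral_image (T := measurableTypeR R) (T' := measurableTypeR R)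
  lebesgue_measure (measurable_translate v) (h := F))//.
  transitivity (\int[lebesgue_measure]_x F x)%E.
    apply: eq_measure_integral => B mB _.
    by symmetry; exact: (lebesgue_measure_translate v mB).
  apply: eq_integral => x _.
  by rewrite /F normal_pdf_translate// !EFinM muleA.
by move=> y; rewrite /F lee_fin mulr_ge0 ?normal_pdf_ge0.
Qed.

End gaussian_shift.

(** * The Cameron-Martin formula for Gaussian noise *)

Section cameron_martin.
Context {R : realType} {d : measure_display} {T : measurableType d}.
Context (P : probability T R) {n : nat} (eps : 'I_n -> {RV P >-> R}) (sigma : R).
Hypotheses (s0 : 0 < sigma) (iid : iid_gaussian sigma eps).

Let event (J : {set 'I_n}) (A : 'I_n -> set R) : set T :=
  \bigcap_(j in [set` J]) (eps j @^-1` A j).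

Let measurable_event J A : (forall j, measurable (A j)) -> measurable (event J A).
Proof.
move=> mA; apply: fin_bigcap_measurable; first exact: finite_finset.
by move=> j _; rewrite -[X in measurable X]setTI; exact: measurable_funPT.
Qed.

(** Independence separates the coordinate that is going to be shifted from all
    the others. *)
Let event_split i A : (forall j, measurable (A j)) ->
  P (eps i @^-1` A i `&` event [set~ i] A) =
  (normal_prob 0 sigma (A i) * P (event [set~ i] A))%E.
Proof.
move=> mA; rewrite -(iid.2 i (A i) (mA i)) (iid.1 _ _ mA) /distribution /pushforward.
rewrite (_ : _ `&` _ = event [set: 'I_n] A); last first.
  apply/seteqP; split=> w.
    move=> [wi wA] j _; case: (eqVneq j i) => [->//|ji].
    by apply: wA; rewrite /= !inE.
  by move=> wA; split=> [|j _]; apply: wA; rewrite /= !inE.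
rewrite (iid.1 _ _ mA) (bigD1 i) ?inE//=; congr (_ * _)%E.
by apply: eq_bigl => j; rewrite !inE.
Qed.

(** Restricted to an event on the other coordinates, the law of [eps i] is the
    normal law times the probability of that event; so independence extends from
    indicators to densities in [eps i]. *)
Let integral_event i A (g : R -> R) : (forall j, measurable (A j)) ->
  measurable_fun setT g -> (forall x, 0 <= g x) ->
  (\int[P]_w ((\1_(event [set~ i] A) w)%:E * (g (eps i w))%:E) =
   P (event [set~ i] A) * \int[normal_prob 0 sigma]_x (g x)%:E)%E.
Proof.
move=> mA mg g0; set B := event _ _.
have mB : measurable B by exact: measurable_event.
have m1B : measurable_fun setT (\1_B : T -> R) by exact: measurable_indic.
have B0 w : 0 <= \1_B w :> R by [].
have mgeps : measurable_fun setT (fun w => (g (eps i w))%:E).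
  by apply/measurable_EFinP; apply: measurableT_comp => //; exact: measurable_funPT.
rewrite -(ge0_integral_density P m1B B0 mgeps); last by move=> w; rewrite lee_fin.
have meps : measurable_fun setT (eps i) by exact: measurable_funPT.
rewrite -(ge0_integral_image (T' := measurableTypeR R) _ meps
  (h := EFin \o g)); last 2 first.
- exact/measurable_EFinP.
- by move=> x; rewrite lee_fin.
have PB : (0 <= fine (P B))%R by exact: fine_ge0.
transitivity (\int[mscale (NngNum PB) (normal_prob 0 sigma)]_x (g x)%:E)%E.
  refine (eq_measure_integral (mscale (NngNum PB) (normal_prob 0 sigma)) _) => C mC _.
  rewrite /image_measure /= /pushforward /density_measure /mscale /=.
  rewrite fineK ?fin_num_measure// integral_indic//; last first.
    by rewrite -[X in measurable X]setTI; exact: meps.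
  pose A' j := if j == i then C else A j.
  have mA' j : measurable (A' j) by rewrite /A'; case: ifP => _; [exact: mC|exact: mA].
  have BE : B = event [set~ i] A'.
    apply/seteqP; split=> w wB j /[dup] + jJ; rewrite /= !inE => /negbTE ji.
      by rewrite /A' ji; exact: wB.
    by have := wB j jJ; rewrite /A' /= ji.
  have := event_split i mA'; rewrite /A' eqxx -/A' -BE setIC muleC.
  exact.
rewrite ge0_integral_mscale//=; last 2 first.
- exact/measurable_EFinP.
- by move=> x; rewrite lee_fin.
by rewrite fineK// fin_num_measure.
Qed.

Definition noise (w : T) : n.-tuple R := [tuple eps j w | j < n].

Lemma measurable_noise : measurable_fun setT noise.
Proof.
apply/measurable_fun_tnthP => j; rewrite (_ : _ \o _ = eps j).
  exact: measurable_funPT.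
by apply/funext => w /=; rewrite tnth_mktuple.
Qed.

Definition tuple_shift (v : 'I_n -> R) (y : n.-tuple R) : n.-tuple R :=
  [tuple v j + tnth y j | j < n].

Lemma measurable_tuple_shift v : measurable_fun setT (tuple_shift v).
Proof.
apply/measurable_fun_tnthP => j.
rewrite (_ : _ \o _ = fun y => v j + tnth y j).
  by apply: measurable_funD => //; exact: measurable_tnth.
by apply/funext => w /=; rewrite tnth_mktuple.
Qed.

Let rectangle (A : 'I_n -> set R) : set (n.-tuple R) :=
  [set y | forall j, A j (tnth y j)].

Let rectangles : set (set (n.-tuple R)) :=
  [set C | exists2 A, (forall j, measurable (A j)) & C = rectangle A].

Let measurable_rectangle A : (forall j, measurable (A j)) ->
  measurable (rectangle A).
Proof.
move=> mA; rewrite (_ : rectangle A =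
  \bigcap_(j in [set` [set: 'I_n]%SET]) (@tnth n R ^~ j @^-1` A j)); last first.
  by apply/seteqP; split=> y yA j => [_|]; apply: yA; rewrite /= ?inE.
apply: fin_bigcap_measurable; first exact: finite_finset.
by move=> j _; rewrite -[X in measurable X]setTI; exact: measurable_tnth.
Qed.

Let rectangles_generate :
  (measurable : set (set (n.-tuple R))) = <<s rectangles >>.
Proof.
apply/seteqP; split; last first.
  apply: smallest_sub; first exact: sigma_algebra_measurable.
  by move=> _ [A mA ->]; exact: measurable_rectangle.
apply: smallest_sub; first exact: smallest_sigma_algebra.
rewrite -bigcup_seq/= => C [j _ [A mA <-]]; apply: sub_sigma_algebra.
exists (fun k => if k == j then A else setT).
  by move=> k; case: ifP.
apply/seteqP; split=> y /=.
  by move=> [_ Ay] k; case: eqP => [->|].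
by move=> /(_ j); rewrite eqxx.
Qed.

(** Both sides integrate [h] against a finite measure on tuples, and it suffices
    to compare these two measures on rectangles.  There independence reduces the
    claim to the one-dimensional translation formula. *)
Lemma shift_one_coordinate (i : 'I_n) (v : R) (h : n.-tuple R -> \bar R) :
  measurable_fun setT h -> (forall y, 0 <= h y)%E ->
  (\int[P]_w h (tuple_shift (fun j => if j == i then v else 0%R) (noise w)) =
   \int[P]_w ((shift_density sigma v (eps i w))%:E * h (noise w)))%E.
Proof.
move=> mh h0; set vi := (X in tuple_shift X).
have meps : measurable_fun setT (eps i) by exact: measurable_funPT.
have mL : measurable_fun setT (fun w => shift_density sigma v (eps i w)).
  by apply: measurableT_comp => //; exact: measurable_shift_density.
have L0 w : 0 <= shift_density sigma v (eps i w) by exact: shift_density_ge0.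
have mhn : measurable_fun setT (fun w => h (noise w)).
  by apply: measurableT_comp => //; exact: measurable_noise.
have msn : measurable_fun setT (fun w => tuple_shift vi (noise w)).
  by apply: measurableT_comp; [exact: measurable_tuple_shift|exact: measurable_noise].
rewrite -(ge0_integral_density P mL L0 mhn)//.
rewrite -(ge0_integral_image _ measurable_noise mh h0).
rewrite -(ge0_integral_image _ msn mh h0).
apply: eq_measure_integral => C mC _.
apply: (measure_unique rectangles (fun=> setT)) => //.
- move=> _ _ [A mA ->] [A' mA' ->]; exists (fun j => A j `&` A' j).
    by move=> j; exact: measurableI.
  apply/seteqP; split=> y /=.
    by move=> [yA yA'] j; split.
  by move=> yA; split=> j; have [] := yA j.
- move=> _; exists (fun=> setT) => //.
  by apply/seteqP; split.
- by rewrite bigcup_const.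
- move=> _ [A mA ->].
  rewrite /image_measure /= /pushforward /density_measure.
  pose A' j := translate (vi j) @^-1` A j.
  have mA' j : measurable (A' j).
    by rewrite -[X in measurable X]setTI; exact: measurable_translate.
  rewrite (_ : _ @^-1` rectangle A = eps i @^-1` A' i `&` event [set~ i] A').
    rewrite event_split// [X in normal_prob _ _ X](_ : _ = translate v @^-1` A i);
      last by rewrite /A' /vi eqxx.
    rewrite normal_prob_translate//.
    have mg : measurable_fun setT (fun x => shift_density sigma v x * \1_(A i) x).
      apply: measurable_funM; first exact: measurable_shift_density.
      exact: measurable_indic.
    have g0 x : 0 <= shift_density sigma v x * \1_(A i) x.
      by rewrite mulr_ge0 ?shift_density_ge0.
    rewrite muleC; refine (etrans (esym (integral_event i mA' mg g0)) _).
    rewrite [RHS]integral_mkcond; apply: eq_integral => w _.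
    rewrite patchE indicE. rewrite -EFinM.
    rewrite (_ : (w \in noise @^-1` rectangle A) =
      (w \in event [set~ i] A') && (eps i w \in A i)); last first.
      apply/idP/andP; rewrite !inE.
        move=> wA; split=> [j|]; last by have := wA i; rewrite tnth_mktuple.
        rewrite /= !inE => /negbTE ji; have := wA j.
        by rewrite tnth_mktuple /A' /vi ji /translate /preimage /= add0r.
      move=> [wB wi] j; rewrite tnth_mktuple; case: (eqVneq j i) => [->//|ji].
      have : A' j (eps j w) by apply: wB; rewrite /= !inE.
      by rewrite /A' /vi (negbTE ji) /translate /preimage /= add0r.
    rewrite indicE; case: (w \in event _ _); case: (eps i w \in A i) => /=;
      by rewrite ?mulr0 ?mul0r ?mulr1 ?mul1r.
  apply/seteqP; split=> w /=.
    move=> wA; split=> [|j _] /=.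
      by have := wA i; rewrite !tnth_mktuple.
    by have := wA j; rewrite !tnth_mktuple.
  move=> [wi wB] j; rewrite !tnth_mktuple; case: (eqVneq j i) => [->//|ji].
  by have := wB j; apply; rewrite /= !inE.
- move=> k; rewrite /image_measure /= /pushforward preimage_setT.
  by rewrite probability_setT ltry.
Qed.

End cameron_martin.

Section likelihood.
Context {R : realType} {d : measure_display} {T : measurableType d}.
Context (P : probability T R) {n : nat} (eps : 'I_n -> {RV P >-> R}) (sigma : R).
Hypotheses (s0 : 0 < sigma) (iid : iid_gaussian sigma eps).

(** The density of the law of [v + noise] with respect to the law of the noise. *)
Definition likelihood (v : 'I_n -> R) (y : n.-tuple R) : R :=
  \prod_(j < n) shift_density sigma (v j) (tnth y j).

Let measurable_prod_density (s : seq 'I_n) (v : 'I_n -> R) :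
  measurable_fun setT (fun y : n.-tuple R =>
    \prod_(j <- s) shift_density sigma (v j) (tnth y j)).
Proof.
elim: s => [|i s IH].
  by rewrite (_ : (fun _ => _) = cst 1)//; apply/funext => y; rewrite big_nil.
under eq_fun do rewrite big_cons.
apply: measurable_funM => //; apply: measurableT_comp => //.
  exact: measurable_shift_density.
exact: measurable_tnth.
Qed.

Lemma measurable_likelihood v : measurable_fun setT (likelihood v).
Proof. exact: measurable_prod_density. Qed.

Lemma likelihood_ge0 v y : 0 <= likelihood v y.
Proof. by rewrite /likelihood prodr_ge0// => j _; rewrite shift_density_ge0. Qed.

(** Shift the coordinates one after the other: the density factor produced by one
    coordinate does not involve the others, hence survives the later shifts
    unchanged. *)
Lemma cameron_martin (v : 'I_n -> R) (h : n.-tuple R -> \bar R) :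
  measurable_fun setT h -> (forall y, 0 <= h y)%E ->
  (\int[P]_w h (tuple_shift v (noise eps w)) =
   \int[P]_w ((likelihood v (noise eps w))%:E * h (noise eps w)))%E.
Proof.
move=> mh h0.
pose vs (s : seq 'I_n) j := if j \in s then v j else 0.
suff H (s : seq 'I_n) : uniq s ->
  forall h : n.-tuple R -> \bar R,
  measurable_fun setT h -> (forall y, 0 <= h y)%E ->
  (\int[P]_w h (tuple_shift (vs s) (noise eps w)) =
   \int[P]_w ((\prod_(j <- s) shift_density sigma (v j) (eps j w))%:E *
              h (noise eps w)))%E.
  have := H _ (enum_uniq 'I_n) h mh h0.
  rewrite (_ : vs _ = v); last by apply/funext => j; rewrite /vs mem_enum.
  move=> ->; apply: eq_integral => w _; rewrite /likelihood big_enum/=.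
  by congr (_%:E * _)%E; apply: eq_bigr => j _; rewrite tnth_mktuple.
elim: s => [_ g mg g0|i s IH /= /andP[si us] g mg g0].
  apply: eq_integral => w _; rewrite big_nil mul1e; congr g.
  by apply: eq_from_tnth => j; rewrite !tnth_mktuple /vs add0r.
pose vi j := if j == i then v i else 0.
pose g1 y := g (tuple_shift vi y).
have mg1 : measurable_fun setT g1.
  by apply: measurableT_comp => //; exact: measurable_tuple_shift.
transitivity (\int[P]_w g1 (tuple_shift (vs s) (noise eps w)))%E.
  apply: eq_integral => w _; rewrite /g1; congr g.
  apply: eq_from_tnth => j; rewrite !tnth_mktuple /vs /vi inE.
  by case: eqVneq => [->|_] /=; rewrite ?(negbTE si) ?add0r.
rewrite IH//; last by move=> y; rewrite /g1.
pose ps (y : n.-tuple R) := \prod_(j <- s) shift_density sigma (v j) (tnth y j).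
have ps0 y : 0 <= ps y by apply: prodr_ge0 => j _; exact: shift_density_ge0.
pose g2 y := ((ps y)%:E * g y)%E.
have mg2 : measurable_fun setT g2.
  apply: emeasurable_funM => //; apply/measurable_EFinP.
  exact: measurable_prod_density.
transitivity (\int[P]_w g2 (tuple_shift vi (noise eps w)))%E.
  apply: eq_integral => w _; rewrite /g2 /g1; congr (_%:E * _)%E.
  rewrite /ps big_seq [RHS]big_seq; apply: eq_bigr => j js.
  rewrite !tnth_mktuple /vi; case: eqVneq => [ji|_]; last by rewrite add0r.
  by move: si; rewrite -ji js.
rewrite (shift_one_coordinate s0 iid)//; last first.
  by move=> y; rewrite /g2 mule_ge0// lee_fin.
apply: eq_integral => w _; rewrite /g2 big_cons EFinM muleA; congr (_ * _%:E * _)%E.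
by rewrite /ps; apply: eq_bigr => j _; rewrite tnth_mktuple.
Qed.

Let measurable_likelihood_noise v :
  measurable_fun setT (fun w => likelihood v (noise eps w)).
Proof.
by apply: measurableT_comp; [exact: measurable_likelihood|exact: measurable_noise].
Qed.

(** One factor of the square is absorbed by [cameron_martin] into a shift of the
    other one; a shifted likelihood is a constant multiple of itself, and its
    mean is 1. *)
Lemma integral_likelihood_sq (v : 'I_n -> R) :
  (\int[P]_w ((likelihood v (noise eps w)) ^+ 2)%:E =
   (expR ((\sum_(j < n) v j ^+ 2) / sigma ^+ 2))%:E)%E.
Proof.
have sn0 : sigma != 0 by rewrite gt_eqF.
transitivity (\int[P]_w (likelihood v (tuple_shift v (noise eps w)))%:E)%E.
  rewrite (cameron_martin v (h := EFin \o likelihood v)).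
  - by apply: eq_integral => w _; rewrite -EFinM expr2.
  - by apply/measurable_EFinP; exact: measurable_likelihood.
  - by move=> y; rewrite lee_fin likelihood_ge0.
transitivity (\int[P]_w ((expR ((\sum_(j < n) v j ^+ 2) / sigma ^+ 2))%:E *
   ((likelihood v (noise eps w))%:E * 1)))%E.
  apply: eq_integral => w _; rewrite mule1 -EFinM; congr EFin.
  rewrite /likelihood mulr_suml expR_sum -big_split/=; apply: eq_bigr => j _.
  rewrite /shift_density !tnth_mktuple -expRD; congr expR; field; exact: sn0.
rewrite ge0_integralZl//; last 2 first.
- by under eq_fun do rewrite mule1; exact/measurable_EFinP.
- by move=> w _; rewrite mule1 lee_fin likelihood_ge0.
rewrite -(cameron_martin v (h := cst 1%E))//=.
by rewrite integral_cst//= probability_setT !mule1.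
Qed.

(** * Testing many Gaussian shifts *)

(** Transport the N hypotheses to the law of the noise: the sum of the success
    probabilities becomes the mean of the sum over [i] of L_i 1_{D = i}.  Since
    L 1 <= N 1 / 2 + L^2 / (2 N) and exactly one of the events [D = i] occurs,
    this mean is at most N / 2 + N sqrt N / (2 N) <= 7 N / 8.  The factor 1/2 in
    the hypothesis is what makes E L_i^2 <= sqrt N. *)
Lemma testing_bound (I : finType) (v : I -> 'I_n -> R) (D : n.-tuple R -> I) :
  (2 <= #|I|)%N ->
  (forall i, measurable (D @^-1` [set i])) ->
  (forall i, \sum_(j < n) v i j ^+ 2 <= sigma ^+ 2 * ln #|I|%:R / 2) ->
  (\sum_i P [set w | D (tuple_shift (v i) (noise eps w)) = i] <=
   (7 / 8 * #|I|%:R)%:E)%E.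
Proof.
move=> I2 mD vle; set N : R := #|I|%:R.
have N2 : 2 <= N by rewrite /N (ler_nat _ 2).
have N0 : 0 < N by apply: lt_le_trans N2.
pose A i := D @^-1` [set i].
pose L i w := likelihood (v i) (noise eps w).
have L0 i w : 0 <= L i w by exact: likelihood_ge0.
have mL i : measurable_fun setT (L i) by exact: measurable_likelihood_noise.
have mA i : measurable_fun setT (\1_(A i) : n.-tuple R -> R).
  by apply: measurable_indic; exact: mD.
have mAn i : measurable_fun setT (fun w => \1_(A i) (noise eps w) : R).
  by apply: measurableT_comp => //; exact: measurable_noise.
rewrite (eq_bigr (fun i => \int[P]_w (L i w * \1_(A i) (noise eps w))%:E)%E); last first.
  move=> i _; under [RHS]eq_integral do rewrite EFinM.
  rewrite -(cameron_martin (v i) (h := EFin \o \1_(A i)))//; last 2 first.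
  - exact/measurable_EFinP.
  - by move=> y /=; rewrite lee_fin.
  pose E := [set w | D (tuple_shift (v i) (noise eps w)) = i].
  have mE : measurable E.
    rewrite -[X in measurable X]setTI.
    have : measurable_fun setT (fun w => tuple_shift (v i) (noise eps w)).
      apply: measurableT_comp; first exact: measurable_tuple_shift.
      exact: measurable_noise.
    by move=> /(_ measurableT (A i)); apply; exact: mD.
  transitivity (\int[P]_w (\1_E w)%:E)%E; first by rewrite integral_indic// setIT.
  by apply: eq_integral => w _; rewrite !indicE.
rewrite -ge0_integral_sum//; last 2 first.
- by move=> i; apply/measurable_EFinP; exact: measurable_funM.
- by move=> i w _; rewrite lee_fin mulr_ge0.
under eq_integral do rewrite sumEFin.
apply: (@le_trans _ _ (\int[P]_w ((N / 2)%:E +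
    \sum_i ((2 * N)^-1%:E * (L i w ^+ 2)%:E)))%E).
  apply: ge0_le_integral => //.
  - by move=> w _; rewrite lee_fin sumr_ge0// => i _; rewrite mulr_ge0.
  - apply/measurable_EFinP; apply: measurable_sum => i; exact: measurable_funM.
  - apply: emeasurable_funD => //; apply: emeasurable_sum => i.
    by apply: emeasurable_funM => //; apply/measurable_EFinP; exact: measurable_funX.
  - move=> w _; under [X in (_ + X)%E]eq_bigr do rewrite -EFinM.
    rewrite sumEFin -EFinD lee_fin.
    have -> : N / 2 = \sum_i (N / 2 * \1_(A i) (noise eps w)).
      rewrite -mulr_sumr (bigD1 (D (noise eps w)))//= big1 ?addr0.
        by rewrite indicE mem_set ?mulr1.
      move=> i iD; rewrite indicE memNset// => /esym.
      exact/eqP.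
    rewrite -big_split/=; apply: ler_sum => i _.
    have := L0 i w; set l := L i w => l0.
    (* The arithmetic-geometric mean inequality, in expanded form. *)
    have sq : 0 <= (2 * N)^-1 * (l - N) ^+ 2.
      by rewrite mulr_ge0 ?sqr_ge0// invr_ge0 mulr_ge0// ltW.
    rewrite indicE; case: (_ \in _); rewrite /= ?mulr1 ?mulr0 ?add0r.
      rewrite -subr_ge0; apply: le_trans sq _; rewrite le_eqVlt; apply/orP; left.
      by apply/eqP; field; rewrite gt_eqF.
    by rewrite mulr_ge0 ?sqr_ge0// invr_ge0 mulr_ge0// ltW.
rewrite ge0_integralD//; last 3 first.
- by move=> w _; rewrite lee_fin divr_ge0// ltW.
- by move=> w _; apply: sume_ge0 => i _; rewrite -EFinM lee_fin mulr_ge0 ?sqr_ge0//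
    invr_ge0 mulr_ge0// ltW.
- apply: emeasurable_sum => i.
  by apply: emeasurable_funM => //; apply/measurable_EFinP; exact: measurable_funX.
rewrite integral_cst//= probability_setT mule1 ge0_integral_sum//; last 2 first.
- move=> i; apply: emeasurable_funM => //.
  by apply/measurable_EFinP; exact: measurable_funX.
- by move=> i w _; rewrite -EFinM lee_fin mulr_ge0 ?sqr_ge0// invr_ge0 mulr_ge0// ltW.
apply: (@le_trans _ _ ((N / 2)%:E + \sum_(i : I) ((2 * N)^-1 * Num.sqrt N)%:E)%E).
  apply: leeD2l; apply: lee_sum => i _.
  rewrite ge0_integralZl//; last 3 first.
  - by apply/measurable_EFinP; exact: measurable_funX.
  - by move=> w _; rewrite lee_fin sqr_ge0.
  - by rewrite lee_fin invr_ge0 mulr_ge0// ltW.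
  rewrite integral_likelihood_sq -EFinM lee_fin ler_wpM2l ?invr_ge0 ?mulr_ge0 ?(ltW N0)//.
  rewrite -[leRHS]lnK ?posrE ?sqrtr_gt0// ler_expR.
  rewrite -powR12_sqrt ?ln_powR ?(ltW N0)//.
  rewrite ler_pdivrMr ?exprn_gt0// (le_trans (vle i))//.
  by rewrite le_eqVlt; apply/orP; left; apply/eqP; field.
rewrite sumEFin -EFinD lee_fin sumr_const -[X in _ + X <= _]mulr_natl -/N.
(* Here N >= 2 is used: sqrt N <= 3 N / 4 as soon as N >= 16 / 9. *)
have sN : Num.sqrt N <= 3 / 4 * N.
  rewrite -ler_sqr ?nnegrE ?sqrtr_ge0 ?mulr_ge0 ?(ltW N0)// sqr_sqrtr ?(ltW N0)//.
  nra.
have -> : N * ((2 * N)^-1 * Num.sqrt N) = Num.sqrt N / 2.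
  by field; rewrite gt_eqF.
lra.
Qed.

End likelihood.

(** * From tests on each block to squared error *)

(** Ties have to be broken measurably: candidates are added one at a time, and a
    new one replaces the current minimizer only where it is strictly better. *)
Lemma measurable_argmin (R : realType) d (T : measurableType d) (I : finType)
    (i0 : I) (l : I -> T -> R) :
  (forall i, measurable_fun setT (l i)) ->
  exists D : T -> I, (forall i, measurable (D @^-1` [set i])) /\
    forall y i, l (D y) y <= l i y.
Proof.
move=> ml.
suff [D [mD Dmin]] : exists D : T -> I,
    (forall i, measurable (D @^-1` [set i])) /\
    forall y i, i \in enum I -> l (D y) y <= l i y.
  by exists D; split=> // y i; apply: Dmin; rewrite mem_enum.
elim: (enum I) => [|i s [D [mD Dmin]]].
  exists (fun=> i0); split=> // i; have [<-|ii0] := eqVneq i0 i.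
    by rewrite (_ : _ @^-1` _ = setT)//; apply/seteqP; split.
  rewrite (_ : _ @^-1` _ = set0)//; apply/seteqP; split=> // y /= /eqP.
  by rewrite (negbTE ii0).
pose E := \bigcup_(j in [set` [set: I]%SET])
  (D @^-1` [set j] `&` [set y | l i y < l j y]).
have mE : measurable E.
  apply: fin_bigcup_measurable; first exact: finite_finset.
  move=> j _; apply: measurableI => //.
  rewrite (_ : [set y | _] = (fun y => l j y - l i y) @^-1` `]0, +oo[%classic).
    rewrite -[X in measurable X]setTI; apply: measurable_funB => //.
  by apply/seteqP; split=> y /=; rewrite in_itv/= andbT subr_gt0.
exists (fun y => if l i y < l (D y) y then i else D y); split; last first.
  move=> y j; rewrite inE => /orP[/eqP->|js]; first by case: ltP.
  have Dj := Dmin y j js.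
  by case: ltP => // /ltW/le_trans; apply.
move=> j.
have EE y : E y <-> l i y < l (D y) y.
  by split=> [[k _ [/= <-]]//|h]; exists (D y) => //=; rewrite inE.
have -> : (fun y => if l i y < l (D y) y then i else D y) @^-1` [set j] =
    (E `&` [set _ | i = j]) `|` (D @^-1` [set j] `\` E).
  apply/seteqP; split=> y /=; case: ltP => h.
  - by move=> ij; left; split=> //; exact/EE.
  - by move=> Dj; right; split=> // /EE; rewrite ltNge h.
  - by case=> [[]//|[_]]; case; exact/EE.
  - by case=> [[/EE]|[]//]; rewrite ltNge h.
apply: measurableU; last exact: measurableD.
apply: measurableI => //; have [->|ij] := eqVneq i j.
  by rewrite (_ : [set _ | _] = setT)//; apply/seteqP; split.
rewrite (_ : [set _ | _] = set0)//; apply/seteqP; split=> // y /= /eqP.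
by rewrite (negbTE ij).
Qed.

Section update.
Context {K I : finType}.

Definition update (J : {ffun K -> I}) (b : K) (c : I) : {ffun K -> I} :=
  [ffun x => if x == b then c else J x].

(** Exchanging [c] with the current value of [J] at [b] is an involution on pairs
    [(J, c)]. *)
Lemma sum_update (R : comNzRingType) (b : K) (F : {ffun K -> I} -> R) :
  \sum_J \sum_c F (update J b c) = #|I|%:R * \sum_J F J.
Proof.
pose h (x : {ffun K -> I} * I) := (update x.1 b x.2, x.1 b).
have hK : involutive h.
  move=> [J c]; rewrite /h /=; congr pair; last by rewrite ffunE eqxx.
  by apply/ffunP => x; rewrite !ffunE; case: eqP => [->|].
rewrite pair_big/= mulr_sumr (reindex_inj (inv_inj hK))/=.
rewrite -(pair_big xpredT xpredT
  (fun J (c : I) => F (update (h (J, c)).1 b (h (J, c)).2)))/=.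
apply: eq_bigr => J _; rewrite -sum1_card natr_sum mulr_suml.
apply: eq_bigr => c _; rewrite mul1r; congr F.
by have := hK (J, c); rewrite /h /= => -[].
Qed.

End update.

Section assouad.
Context {R : realType} {d : measure_display} {T : measurableType d}.
Context (P : probability T R) {n : nat} (eps : 'I_n -> {RV P >-> R}) (sigma : R).
Hypotheses (s0 : 0 < sigma) (iid : iid_gaussian sigma eps).
Context {K I : finType} (i0 : I) (I2 : (2 <= #|I|)%N).
Variables (m : {ffun K -> I} -> 'I_n -> R) (delta : R).
Hypothesis delta0 : 0 <= delta.
Hypothesis separated : forall J J' : {ffun K -> I},
  delta * (\sum_b (J b != J' b)%:R) <= \sum_(i < n) (m J i - m J' i) ^+ 2.
Hypothesis close : forall J b c,
  \sum_(i < n) (m (update J b c) i - m (update J b i0) i) ^+ 2 <=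
  sigma ^+ 2 * ln #|I|%:R / 2.

Let obs J w := tuple_shift (m J) (noise eps w).

Let measurable_obs J : measurable_fun setT (obs J).
Proof.
by apply: measurableT_comp; [exact: measurable_tuple_shift|exact: measurable_noise].
Qed.

(** For each block, [testing_bound] applies to the laws that differ only on that
    block, translated to a common centre; averaging over all [J] shows that every
    block is wrong with average probability at least 1/8.  Some [J] does at least
    as badly as the average. *)
Lemma block_error (D : n.-tuple R -> {ffun K -> I}) :
  (forall J, measurable (D @^-1` [set J])) ->
  exists J, #|K|%:R / 8 <=
    \sum_b fine (P [set w | D (obs J w) b != J b]).
Proof.
move=> mD.
have mDb (b : K) (c : I) : measurable ((fun y => D y b) @^-1` [set c]).
  rewrite (_ : _ @^-1` _ =
    \bigcup_(J in [set` [set J : {ffun K -> I} | J b == c]%SET]) (D @^-1` [set J])).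
    by apply: fin_bigcup_measurable => //; exact: finite_finset.
  apply/seteqP; split=> y /=.
    by move=> yc; exists (D y) => //=; rewrite inE yc.
  by move=> [J /=]; rewrite inE => /eqP <- ->.
have mobs J b c : measurable [set w | D (obs J w) b = c].
  rewrite -[X in measurable X]setTI.
  exact: (measurable_obs J measurableT (mDb b c)).
pose p J b := fine (P [set w | D (obs J w) b != J b]).
pose q J b := fine (P [set w | D (obs J w) b = J b]).
have pq J b : p J b = 1 - q J b.
  rewrite /p (_ : [set w | _] = ~` [set w | D (obs J w) b = J b]).
    rewrite probability_setC// fineB ?fin_num_measure//.
  by apply/seteqP; split=> w /=; move/eqP.
have qle J b : \sum_c q (update J b c) b <= 7 / 8 * #|I|%:R.
  rewrite -lee_fin -sumEFin.
  pose v c i := m (update J b c) i - m (update J b i0) i.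
  pose D' y := D (tuple_shift (m (update J b i0)) y) b.
  have mD' c : measurable (D' @^-1` [set c]).
    rewrite -[X in measurable X]setTI.
    exact: (measurable_tuple_shift (m (update J b i0)) measurableT (mDb b c)).
  apply: le_trans (testing_bound s0 iid I2 mD' (v := v) (close J b)).
  apply: lee_sum => c _; rewrite /q fineK ?fin_num_measure//.
  rewrite le_eqVlt; apply/orP; left; apply/eqP; congr (P _).
  apply/seteqP; split=> w /=; rewrite ffunE eqxx /D' /obs => h.
    rewrite -[RHS]h; congr (D _ _).
    by apply: eq_from_tnth => i; rewrite !tnth_mktuple /v; ring.
  rewrite -[RHS]h; congr (D _ _).
  by apply: eq_from_tnth => i; rewrite !tnth_mktuple /v; ring.
have N0 : 0 < #|I|%:R :> R by rewrite ltr0n (leq_trans _ I2).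
pose C : R := #|{ffun K -> I}|%:R.
have C0 : 0 < C.
  by rewrite ltr0n; apply/card_gt0P; exists [ffun=> i0].
have ple b : C / 8 <= \sum_J p J b.
  under eq_bigr do rewrite pq.
  rewrite sumrB sumr_const -/C.
  have : #|I|%:R * \sum_J q J b <= #|I|%:R * (7 / 8 * C).
    rewrite -(sum_update b (fun J => q J b)).
    apply: le_trans (ler_sum _ (fun J _ => qle J b)) _.
    by rewrite sumr_const -/C -mulr_natl; lra.
  rewrite ler_pM2l//; lra.
apply/existsP; apply: contraT; rewrite negb_exists => /forallP all_lt.
have : \sum_J \sum_b p J b < \sum_(J : {ffun K -> I}) #|K|%:R / 8.
  apply: ltr_sum; last by move=> J _; rewrite ltNge; exact: all_lt.
  by apply/hasP; exists [ffun=> i0] => //; rewrite mem_index_enum.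
rewrite exchange_big/= ltNge => /negP[].
apply: le_trans (ler_sum _ (fun b _ => ple b)).
by rewrite !sumr_const -[leLHS]mulr_natl -[leRHS]mulr_natl -/C; lra.
Qed.

(** Let [D] choose the mean nearest to the estimate [g].  The mean chosen by [D] is
    at least as close to [g] as the true one, so it is within twice the error of
    the true mean: by [separated], the squared error is at least delta / 4 times
    the number of blocks where [D] is wrong. *)
Lemma assouad_risk (g : 'I_n -> n.-tuple R -> R) :
  (forall i, measurable_fun setT (g i)) ->
  exists J, ((delta * #|K|%:R / 32)%:E <=
    \int[P]_w (\sum_(i < n) (g i (obs J w) - m J i) ^+ 2)%:E)%E.
Proof.
move=> mg; pose l J y := \sum_(i < n) (g i y - m J i) ^+ 2.
have ml J : measurable_fun setT (l J).
  apply: measurable_sum => i; apply: measurable_funX.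
  exact: measurable_funB.
have [D [mD Dmin]] := measurable_argmin [ffun=> i0] ml.
have [J HJ] := block_error mD; exists J.
have lD y : delta / 4 * \sum_b (D y b != J b)%:R <= l J y.
  have := separated (D y) J; have := Dmin y J.
  suff : \sum_(i < n) (m (D y) i - m J i) ^+ 2 <= 2 * l (D y) y + 2 * l J y by lra.
  rewrite /l !mulr_sumr -big_split/=; apply: ler_sum => i _.
  rewrite -subr_ge0 (_ : _ - _ = (2 * g i y - m (D y) i - m J i) ^+ 2) ?sqr_ge0//.
  by ring.
have mE b : measurable [set w | D (obs J w) b != J b].
  rewrite (_ : [set w | _] = obs J @^-1`
    \bigcup_(J' in [set` [set J' : {ffun K -> I} | J' b != J b]%SET])
      (D @^-1` [set J'])).
    rewrite -[X in measurable X]setTI; apply: measurable_obs => //.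
    by apply: fin_bigcup_measurable => //; exact: finite_finset.
  apply/seteqP; split=> w /=.
    by move=> yc; exists (D (obs J w)) => //=; rewrite inE.
  by move=> [J' /=]; rewrite inE => h ->.
have mloss : measurable_fun setT (fun w => l J (obs J w)) by exact: measurableT_comp.
apply: (@le_trans _ _ (\int[P]_w ((delta / 4)%:E *
    \sum_b (\1_[set w | D (obs J w) b != J b] w)%:E))%E); last first.
  apply: ge0_le_integral => //.
  - by move=> w _; rewrite sumEFin -EFinM lee_fin mulr_ge0 ?divr_ge0// sumr_ge0.
  - apply: emeasurable_funM => //; apply: emeasurable_sum => b.
    by apply/measurable_EFinP; exact: measurable_indic.
  - exact/measurable_EFinP.
  - move=> w _; rewrite sumEFin -EFinM lee_fin.
    apply: le_trans (lD (obs J w)); rewrite ler_wpM2l ?divr_ge0//.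
    apply: ler_sum => b _; rewrite indicE ler_nat.
    by case: (boolP (_ \in _)); rewrite ?inE//= => ->.
rewrite ge0_integralZl//; last 3 first.
- by apply: emeasurable_sum => b; apply/measurable_EFinP; exact: measurable_indic.
- by move=> w _; rewrite sumEFin lee_fin sumr_ge0.
- by rewrite lee_fin divr_ge0.
rewrite ge0_integral_sum//; last first.
  by move=> b; apply/measurable_EFinP; exact: measurable_indic.
rewrite (eq_bigr (fun b => (fine (P [set w | D (obs J w) b != J b]))%:E)); last first.
  by move=> b _; rewrite integral_indic// setIT fineK// fin_num_measure.
rewrite sumEFin -EFinM lee_fin.
apply: le_trans (ler_wpM2l _ HJ); last by rewrite divr_ge0.
by lra.
Qed.

End assouad.

(** * Block-sparse coefficient vectors *)

Section block_vectors.
Context {R : realType} {M k s : nat}.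
Hypothesis ksM : (k * s <= M)%N.
Variable lambda : R.

Let card_le : (#|{: 'I_k * 'I_s}| <= M)%N.
Proof. by rewrite card_prod !card_ord. Qed.

(** Any injection will do: it makes k blocks of s coordinates each out of the
    first k * s coordinates. *)
Definition slot (x : 'I_k * 'I_s) : 'I_M := widen_ord card_le (enum_rank x).

Lemma slot_inj : injective slot.
Proof. by move=> x y /(congr1 val)/= /val_inj/enum_rank_inj. Qed.

Definition chosen (J : {ffun 'I_k -> option 'I_s}) : {set 'I_k * 'I_s} :=
  [set x | J x.1 == Some x.2].

Definition block_vector (J : {ffun 'I_k -> option 'I_s}) : 'cV[R]_M :=
  \col_j (lambda * (j \in slot @: chosen J)%:R).

Lemma block_vector_slot J x :
  block_vector J (slot x) 0 = lambda * (x \in chosen J)%:R.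
Proof. by rewrite mxE mem_imset//; exact: slot_inj. Qed.

(** A block contributes at most one coordinate. *)
Lemma card_chosen J : (#|slot @: chosen J| <= k)%N.
Proof.
rewrite card_imset; last exact: slot_inj.
rewrite -(card_in_imset (f := fst)); last first.
  move=> [b c] [b' c']; rewrite !inE/= => /eqP Jb /eqP Jb' bb'.
  by move: Jb'; rewrite -bb' Jb => -[->].
by rewrite (leq_trans (max_card _))// card_ord.
Qed.

Lemma l0norm_block_vector J : (l0norm (block_vector J) <= k)%N.
Proof.
apply: leq_trans (card_chosen J); apply: subset_leq_card.
apply/fintype.subsetP => j; rewrite !inE mxE.
by case: (j \in _); rewrite ?mulr0 ?eqxx.
Qed.

Lemma l0norm_block_vectorB J J' :
  (l0norm (block_vector J - block_vector J') <= 2 * k)%N.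
Proof.
rewrite mul2n -addnn.
apply: (@leq_trans #|(slot @: chosen J) :|: (slot @: chosen J')|%SET).
  apply: subset_leq_card; apply/fintype.subsetP => j; rewrite !inE !mxE.
  by case: (j \in _) => //; case: (j \in _); rewrite // subrr eqxx.
rewrite (leq_trans (leq_card_setU _ _))//.
by apply: leq_add; exact: card_chosen.
Qed.

Lemma lqnorm_block_vector (q : R) J : 0 < q -> 0 <= lambda ->
  lqnorm q (block_vector J) <= lambda * k%:R `^ q^-1.
Proof.
move=> q0 l0; rewrite /lqnorm.
have -> : lambda * k%:R `^ q^-1 = (lambda `^ q * k%:R) `^ q^-1.
  by rewrite powRM ?powR_ge0// -powRrM mulfV ?gt_eqF// powRr1.
apply: ge0_ler_powR; rewrite ?nnegrE ?invr_ge0 ?(ltW q0)//.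
- by apply: sumr_ge0 => j _; exact: powR_ge0.
- by rewrite mulr_ge0 ?powR_ge0.
rewrite (eq_bigr (fun j => lambda `^ q * (j \in slot @: chosen J)%:R)); last first.
  move=> j _; rewrite mxE; case: (j \in _); rewrite ?mulr1 ?mulr0.
    by rewrite ger0_norm.
  by rewrite normr0 powR0// gt_eqF.
rewrite -mulr_sumr ler_wpM2l ?powR_ge0// -natr_sum ler_nat.
apply: leq_trans (card_chosen J).
by rewrite -sum1_card [leqRHS]big_mkcond/= leq_sum// => j _; case: (_ \in _).
Qed.

(** Where [J b] and [J' b] differ, at least one of them is a coordinate, and there
    the two vectors differ by lambda. *)
Lemma block_vector_separated (J J' : {ffun 'I_k -> option 'I_s}) :
  lambda ^+ 2 * (\sum_b (J b != J' b)%:R) <=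
  \sum_(j < M) (block_vector J - block_vector J') j 0 ^+ 2.
Proof.
apply: (@le_trans _ _ (\sum_(j in slot @: {: 'I_k * 'I_s})
    (block_vector J - block_vector J') j 0 ^+ 2)); last first.
  rewrite [leRHS](bigID (mem (slot @: {: 'I_k * 'I_s})))/=.
  by rewrite lerDl sumr_ge0// => j _; exact: sqr_ge0.
rewrite big_imset/=; last by move=> x y _ _; exact: slot_inj.
rewrite mulr_sumr (_ : \sum_(x in _) _ = \sum_b \sum_c
  (block_vector J - block_vector J') (slot (b, c)) 0 ^+ 2); last first.
  by rewrite pair_big/=; apply: eq_big => [[]|[]].
apply: ler_sum => b _.
have term c : (block_vector J - block_vector J') (slot (b, c)) 0 ^+ 2 =
    lambda ^+ 2 * ((J b == Some c)%:R - (J' b == Some c)%:R) ^+ 2.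
  rewrite mxE [X in _ + X]mxE !block_vector_slot !inE/= -mulrBr.
  by rewrite exprMn.
under eq_bigr do rewrite term.
have ge0 c : 0 <= lambda ^+ 2 * ((J b == Some c)%:R - (J' b == Some c)%:R) ^+ 2.
  by rewrite mulr_ge0// sqr_ge0.
have [JJ'|JJ'] := eqVneq (J b) (J' b).
  by rewrite mulr0; apply: sumr_ge0 => c _.
have [c Hc] : exists c, ((J b == Some c)%:R - (J' b == Some c)%:R) ^+ 2 = 1 :> R.
  case Jb : (J b) => [c|].
    exists c; rewrite eqxx; case: eqP => [E|_]; last by rewrite subr0 expr1n.
    by move: JJ'; rewrite Jb E eqxx.
  case J'b : (J' b) => [c|]; last by move: JJ'; rewrite Jb J'b eqxx.
  by exists c; rewrite eqxx /= sub0r sqrrN expr1n.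
rewrite mulr1 (bigD1 c)//= Hc mulr1 lerDl.
by apply: sumr_ge0 => c' _.
Qed.

(** The form in which the hypotheses on one block become visible: after
    multiplication by the design they are shifts, by lambda times one column, of
    the hypothesis of an empty block. *)
Lemma block_vector_update J b c :
  block_vector (update J b (Some c)) =
  block_vector (update J b None) + lambda *: delta_mx (slot (b, c)) 0.
Proof.
apply/matrixP => j o; rewrite ord1 !mxE eqxx andbT -mulrDr; congr (_ * _).
have [/imsetP[[b' c'] _ ->]|jn] := boolP (j \in slot @: {: 'I_k * 'I_s}).
  rewrite !mem_imset; try exact: slot_inj.
  rewrite (inj_eq slot_inj) !inE/= !ffunE xpair_eqE.
  case: (b' == b) => /=; last by rewrite addr0.
  by rewrite add0r (inj_eq Some_inj) eq_sym.
have jS J' : (j \in slot @: chosen J') = false.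
  apply: contraNF jn; apply: (fintype.subsetP (imsetS _ _)).
  exact/fintype.subsetP.
rewrite !jS add0r; case: eqP => // jE; move: jn; rewrite jE.
by rewrite imset_f.
Qed.

End block_vectors.

Section design.
Context {R : realType} {n M : nat} (X : 'M[R]_(n, M)).

Lemma lin_fct_design (theta : 'cV[R]_M) i :
  lin_fct theta (design_point X i) = (X *m theta) i 0.
Proof.
by rewrite mxE; apply: eq_bigr => j _; rewrite /design_point !mxE mulrC.
Qed.

Lemma lqnorm2_sq m (v : 'cV[R]_m) : lqnorm 2 v ^+ 2 = \sum_(j < m) v j 0 ^+ 2.
Proof.
rewrite /lqnorm powR12_sqrt; last by apply: sumr_ge0 => j _; exact: powR_ge0.
rewrite sqr_sqrtr; last by apply: sumr_ge0 => j _; exact: powR_ge0.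
by apply: eq_bigr => j _; rewrite powR_mulrn ?normr_ge0// real_normK ?num_real.
Qed.

Lemma SRC'_lower (k : nat) (alow aup : R) (theta : 'cV[R]_M) :
  0 < alow -> (0 < n)%N -> SRC' X k%:R alow aup -> (l0norm theta <= 2 * k)%N ->
  n%:R * alow ^+ 2 * (\sum_(j < M) theta j 0 ^+ 2) <=
  \sum_(i < n) (X *m theta) i 0 ^+ 2.
Proof.
move=> a0 n0 src th.
have [|+ _] := src theta.
  rewrite le_min -natrM ler_nat th ler_nat.
  by rewrite (leq_trans (max_card _))// card_ord.
move=> h.
have : (alow * lqnorm 2 theta) ^+ 2 <=
    ((Num.sqrt n%:R)^-1 * lqnorm 2 (X *m theta)) ^+ 2.
  have p0 m (v : 'cV[R]_m) : 0 <= lqnorm 2 v by exact: powR_ge0.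
  by rewrite ler_sqr ?nnegrE ?mulr_ge0 ?invr_ge0 ?sqrtr_ge0 ?(ltW a0).
rewrite !exprMn !lqnorm2_sq exprVn sqr_sqrtr//.
by rewrite ler_pdivlMl ?ltr0n// mulrA.
Qed.

End design.

Section block_risk.
Context {R : realType} {d : measure_display} {T : measurableType d}.
Context (P : probability T R) {n M : nat} (X : 'M[R]_(n, M)).
Context (eps : 'I_n -> {RV P >-> R}) (sigma : R).

(** [assouad_risk] for the means of the block vectors: the restricted isometry
    gives the separation n alow^2 lambda^2, and the normalization of the columns
    gives the closeness, since moving one block changes the mean by a vector of
    squared length at most n lambda^2. *)
Lemma block_risk (k s : nat) (lambda alow aup : R)
    (F : set ('cV[R]_M -> R)) (ksM : (k * s <= M)%N) :
  0 < sigma -> (0 < n)%N -> (0 < s)%N -> 0 < alow ->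
  iid_gaussian sigma eps -> normalized_design X -> SRC' X k%:R alow aup ->
  lambda ^+ 2 <= sigma ^+ 2 * ln s.+1%:R / (2 * n%:R) ->
  (forall J, F (lin_fct (block_vector ksM lambda J))) ->
  ((alow ^+ 2 / 32 * (lambda ^+ 2 * k%:R))%:E <= minimax_risk X eps F)%E.
Proof.
move=> s0 n0 ss0 a0 iid nd src lle FJ.
have nR0 : 0 < n%:R :> R by rewrite ltr0n.
pose m J i := (X *m block_vector ksM lambda J) i 0.
pose delta := n%:R * alow ^+ 2 * lambda ^+ 2.
have delta0 : 0 <= delta by rewrite /delta mulr_ge0 ?sqr_ge0 // mulr_ge0 ?sqr_ge0.
have sep (J J' : {ffun 'I_k -> option 'I_s}) :
    delta * (\sum_b (J b != J' b)%:R) <= \sum_(i < n) (m J i - m J' i) ^+ 2.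
  rewrite (eq_bigr (fun i =>
    (X *m (block_vector ksM lambda J - block_vector ksM lambda J')) i 0 ^+ 2)); last first.
    move=> i _; congr (_ ^+ 2); rewrite mulmxBr [RHS]mxE; congr (_ + _).
    by rewrite [RHS]mxE.
  apply: le_trans (SRC'_lower a0 n0 src (l0norm_block_vectorB _ _ _ _)).
  rewrite /delta -mulrA; apply: ler_wpM2l; last exact: block_vector_separated.
  by rewrite mulr_ge0// sqr_ge0.
have I2 : (2 <= #|{: option 'I_s}|)%N by rewrite card_option card_ord.
have cl J b (c : option 'I_s) :
    \sum_(i < n) (m (update J b c) i - m (update J b None) i) ^+ 2 <=
    sigma ^+ 2 * ln #|{: option 'I_s}|%:R / 2.
  have B0 : 0 <= sigma ^+ 2 * ln #|{: option 'I_s}|%:R / 2.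
    by rewrite divr_ge0// mulr_ge0 ?sqr_ge0// ln_ge0// ler1n ltnW.
  case: c => [c|]; last by rewrite big1// => i _; rewrite subrr expr0n.
  rewrite (eq_bigr (fun i => lambda ^+ 2 * X i (slot ksM (b, c)) ^+ 2)); last first.
    move=> i _; rewrite /m block_vector_update mulmxDr mxE addrAC subrr add0r.
    by rewrite -scalemxAr mxE -colE mxE exprMn.
  rewrite -mulr_sumr card_option card_ord.
  apply: (@le_trans _ _ (lambda ^+ 2 * n%:R)).
    rewrite ler_wpM2l ?sqr_ge0//; have := nd (slot ksM (b, c)).
    by rewrite ler_pdivrMr// mul1r.
  apply: (@le_trans _ _ (sigma ^+ 2 * ln s.+1%:R / (2 * n%:R) * n%:R)).
    by rewrite ler_wpM2r.
  by rewrite le_eqVlt; apply/orP; left; apply/eqP; field; rewrite gt_eqF.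
apply/ereal_infP => _ [fhat est <-].
pose g i y := fhat y (design_point X i).
have mg i : measurable_fun setT (g i) by exact: est.
have [J HJ] := assouad_risk s0 iid I2 delta0 sep cl mg.
apply: le_ereal_sup_tmp; eexists; first by exists (lin_fct (block_vector ksM lambda J)).
have n1 : 0 <= n%:R^-1 :> R by rewrite invr_ge0.
rewrite unlock.
have respE w : response X (lin_fct (block_vector ksM lambda J)) eps w =
    tuple_shift (m J) (noise eps w).
  by apply: eq_from_tnth => i; rewrite !tnth_mktuple lin_fct_design.
rewrite (eq_integral (fun w => (n%:R^-1)%:E *
    (\sum_(i < n) (g i (tuple_shift (m J) (noise eps w)) - m J i) ^+ 2)%:E)%E); last first.
  move=> w _; rewrite -EFinM /ASE /sq_normn respE; congr (_ * _)%:E.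
  by apply: eq_bigr => i _; rewrite lin_fct_design.
have mobs : measurable_fun setT (fun w => tuple_shift (m J) (noise eps w)).
  by apply: measurableT_comp; [exact: measurable_tuple_shift|exact: measurable_noise].
rewrite ge0_integralZl//; last 2 first.
- apply/measurable_EFinP; apply: measurable_sum => i; apply: measurable_funX.
  by apply: measurable_funB => //; exact: measurableT_comp.
- by move=> w _; rewrite lee_fin sumr_ge0// => i _; exact: sqr_ge0.
apply: le_trans (lee_wpmul2l _ HJ); last by rewrite lee_fin.
rewrite -EFinM lee_fin card_ord le_eqVlt; apply/orP; left; apply/eqP.
by rewrite /delta; field; rewrite gt_eqF.
Qed.

End block_risk.

(** * Comparing the rates with the block construction *)

Section logarithms.
Context {R : realType}.
Implicit Types x y : R.

(** From ln (1 + x) <= x at x = -1/2. *)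
Lemma ln2_ge_half : 1 / 2 <= ln 2 :> R.
Proof.
have := @le_ln1Dx R (- (1 / 2)).
have -> : 1 + - (1 / 2) = 2^-1 :> R by lra.
by rewrite lnV ?posrE//; move=> /(_ ltac:(lra)); lra.
Qed.

(** The block size plus one exceeds M / k and is at least 2, so its logarithm
    dominates both ln (M / k) and 1/2; the factor 1/3 balances the two. *)
Lemma ln_block_size (M k : nat) : (1 <= k <= M)%N ->
  (1 + ln (M%:R / k%:R)) / 3 <= ln ((M %/ k).+1%:R) :> R.
Proof.
move=> /andP[k1 kM]; set N := (M %/ k).+1.
have k0 : 0 < k%:R :> R by rewrite ltr0n.
have N2 : 2 <= N%:R :> R by rewrite (ler_nat _ 2) ltnS divn_gt0.
have h1 : ln 2 <= ln N%:R :> R by rewrite ler_ln ?posrE//; lra.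
have h2 : ln (M%:R / k%:R) <= ln N%:R :> R.
  rewrite ler_ln ?posrE; last 2 first.
  - by rewrite divr_gt0// ltr0n (leq_trans k1).
  - by lra.
  by rewrite ler_pdivrMr// -natrM ler_nat ltnW// ltn_ceil.
have := ln2_ge_half; lra.
Qed.

Lemma ceil_nat x : 0 < x ->
  [/\ (0 < `|Num.ceil x|)%N, x <= `|Num.ceil x|%N%:R & `|Num.ceil x|%N%:R < x + 1].
Proof.
move=> x0.
have c0 : (0 < Num.ceil x)%R by rewrite ceil_gt0.
have cE : `|Num.ceil x|%N%:R = (Num.ceil x)%:~R :> R.
  by rewrite natr_absz gtr0_norm.
split.
- by rewrite absz_gt0 gt_eqF.
- by rewrite cE ceil_ge.
- by rewrite cE -ltrBlDr; have := ceil_itv x; rewrite intrD => /andP[].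
Qed.

End logarithms.

Section rates.
Context {R : realType} (n M : nat) (sigma q t : R).
Hypotheses (n2 : (2 <= n)%N) (M2 : (2 <= M)%N) (s0 : 0 < sigma) (t0 : 0 < t).
Hypothesis (q01 : 0 < q <= 1).

Let q0 : 0 < q. Proof. by case/andP: q01. Qed.
Let n0 : 0 < n%:R :> R. Proof. by rewrite ltr0n (leq_trans _ n2). Qed.
(* [W] is the squared radius measured in units of the noise level sigma^2 / n, and
   [A] is its power q / 2, so that [m] is about A divided by a power of a
   logarithm.  They are variables constrained by equations, since the rules for
   logarithms of products and powers would otherwise unfold them. *)
Variables W A noise_level : R.
Hypotheses (W_def : W = n%:R * t ^+ 2 * sigma ^- 2) (A_def : A = W `^ (q / 2)).
Hypothesis noise_level_def : noise_level = sigma ^+ 2 / n%:R.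
Let m := eff_lower n M sigma q t.
Let mup := eff_upper n M sigma q t.
Let U : R := 1 + ln (M%:R / mup%:R).

Let W0 : 0 < W.
Proof. by rewrite W_def divr_gt0 ?exprn_gt0// mulr_gt0// exprn_gt0. Qed.

Let A0 : 0 < A. Proof. by rewrite A_def powR_gt0. Qed.

Let minMn2 : (2 <= minn M n)%N. Proof. by rewrite leq_min M2. Qed.

Let mupE : mup = minn `|Num.ceil A|%N (minn M n).
Proof. by rewrite /mup /eff_upper A_def W_def minnA. Qed.

Let mup_gt0 : (0 < mup)%N.
Proof.
rewrite mupE leq_min (leq_trans _ minMn2)// andbT.
by have [] := ceil_nat A0.
Qed.

Let mup_le : (mup <= minn M n)%N. Proof. by rewrite mupE geq_minr. Qed.

Let U1 : 1 <= U.
Proof.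
rewrite /U lerDl ln_ge0// ler_pdivlMr ?ltr0n// mul1r ler_nat.
by rewrite (leq_trans mup_le)// geq_minl.
Qed.

Let U0 : 0 < U. Proof. by apply: lt_le_trans U1. Qed.

Let effective_dimension_full : mup = minn M n -> m = minn M n /\ m%:R <= 2 * A.
Proof.
move=> mupF; have mE : m = mup.
  by rewrite /m /eff_lower -/mup mupF eqxx.
split; first by rewrite mE.
have [_ _ cA] := ceil_nat A0.
have : m%:R <= `|Num.ceil A|%N%:R :> R by rewrite ler_nat mE mupE geq_minl.
have : 2 <= m%:R :> R by rewrite (ler_nat _ 2) mE mupF.
lra.
Qed.

(** With [mup] the rounding up of [A] and U = 1 + ln (M / mup), the number [m] is
    the rounding up of mup / U^(q/2). *)
Let effective_dimension_sparse : mup != minn M n ->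
  [/\ (0 < m <= mup)%N, (mup < minn M n)%N, A <= mup%:R,
      mup%:R < A + 1 & mup%:R <= m%:R * U `^ (q / 2) < mup%:R + U `^ (q / 2)].
Proof.
move=> mupF; have lt_mup : (mup < minn M n)%N by rewrite ltn_neqAle mupF.
have mupC : mup = `|Num.ceil A|%N.
  move: lt_mup; rewrite mupE gtn_min ltnn orbF => /ltnW.
  by move=> /minn_idPl.
have [_ cA1 cA2] := ceil_nat A0.
have Y1 : 1 <= U `^ (q / 2).
  by rewrite -[leLHS](powRr0 U) ler_powR// divr_ge0// ltW.
have Y0 : 0 < U `^ (q / 2) by apply: lt_le_trans Y1.
have mup0 : 0 < mup%:R :> R by rewrite ltr0n.
have mE : m = `|Num.ceil (mup%:R / U `^ (q / 2))|%N.
  by rewrite /m /eff_lower -/mup (negbTE mupF).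
have [m0 cm1 cm2] := ceil_nat (divr_gt0 mup0 Y0).
split; [|exact: lt_mup|by rewrite mupC|by rewrite mupC|].
- rewrite mE m0/= -(ler_nat R) natr_absz gtr0_norm ?ceil_gt0 ?divr_gt0//.
  rewrite -[leRHS]/((mup%:Z)%:~R) ler_int ceil_le_int.
  by rewrite ler_pdivrMr// ler_peMr// ltW.
- rewrite mE -ler_pdivrMr// cm1/=.
  by rewrite -ltr_pdivlMr// mulrDl divff ?gt_eqF.
Qed.

Lemma eff_lower_gt0 : (0 < m)%N.
Proof.
have [/effective_dimension_full[-> _]|/effective_dimension_sparse[]] :=
  eqVneq mup (minn M n); first by rewrite (leq_trans _ minMn2).
by case/andP.
Qed.

Lemma eff_lower_le : (m <= minn M n)%N.
Proof.
have [/effective_dimension_full[-> _]//|/effective_dimension_sparse[]] :=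
  eqVneq mup (minn M n).
by move=> /andP[_ mm] h _ _ _; rewrite (leq_trans mm)// ltnW.
Qed.

Let m0 : 0 < m%:R :> R. Proof. by rewrite ltr0n eff_lower_gt0. Qed.

Let noise_level0 : 0 < noise_level.
Proof. by rewrite noise_level_def divr_gt0// exprn_gt0. Qed.

Let sq_radius : t ^+ 2 = noise_level * W.
Proof. by rewrite noise_level_def W_def; field; rewrite !gt_eqF. Qed.

Let W_eq : W = A `^ (2 / q).
Proof.
rewrite A_def -powRrM (_ : q / 2 * (2 / q) = 1) ?powRr1 ?(ltW W0)//.
by field; rewrite gt_eqF.
Qed.

Let lnW : ln W = 2 / q * ln A. Proof. by rewrite W_eq ln_powR. Qed.

Variable r : nat.
Hypothesis rMn : (r <= minn M n)%N.

Let c : R := 4 `^ (- (2 / q)).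

Let c0 : 0 < c. Proof. exact: powR_gt0. Qed.

(** The exponent 2 / q is at least 2. *)
Lemma rate_constant_le : c <= 1 / 16.
Proof.
have -> : 1 / 16 = 4 `^ (- 2%:R) :> R.
  by rewrite powRN powR_mulrn//; field.
rewrite /c ler_powR//; first by rewrite ler1n.
by rewrite lerN2 ler_pdivlMr//; case/andP: q01; lra.
Qed.


Let V : R := 1 + ln (M%:R / A).

Let sparse_rate : R := sigma `^ (2 - q) * t `^ q * (V / n%:R) `^ (1 - q / 2).

Let sparse_rateE : 0 < V -> sparse_rate = noise_level * (A * V `^ (1 - q / 2)).
Proof.
move=> V0.
have s_pos : 0 < sigma `^ (2 - q) by exact: powR_gt0.
have t_pos : 0 < t `^ q by exact: powR_gt0.
have Vn0 : 0 < V / n%:R by exact: divr_gt0.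
have Vn_pos : 0 < (V / n%:R) `^ (1 - q / 2) by exact: powR_gt0.
have V_pos : 0 < V `^ (1 - q / 2) by exact: powR_gt0.
have sparse_rate0 : 0 < sparse_rate by apply: mulr_gt0 => //; exact: mulr_gt0.
have L0 := noise_level0.
apply: ln_inj; rewrite ?posrE//; first by apply: mulr_gt0 => //; exact: mulr_gt0.
have lnL : ln noise_level = 2 * ln sigma - ln n%:R.
  by rewrite noise_level_def ln_div ?posrE ?exprn_gt0// lnXn// mulr_natl.
have lnA : ln A = q / 2 * (ln n%:R + 2 * ln t - 2 * ln sigma).
  rewrite A_def ln_powR; congr (_ * _).
  rewrite W_def ln_div ?posrE ?exprn_gt0//; last by rewrite mulr_gt0 ?exprn_gt0.
  by rewrite lnM ?posrE ?exprn_gt0// !lnXn// !mulr_natl.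
have lnVn : ln (V / n%:R) = ln V - ln n%:R by rewrite ln_div ?posrE.
have AV0 : 0 < A * V `^ (1 - q / 2) by exact: mulr_gt0.
have st0 : 0 < sigma `^ (2 - q) * t `^ q by exact: mulr_gt0.
rewrite /sparse_rate (lnM (x := sigma `^ (2 - q) * t `^ q)) ?posrE//.
rewrite (lnM (x := sigma `^ (2 - q))) ?posrE//.
rewrite (lnM (x := noise_level)) ?posrE// (lnM (x := A)) ?posrE//.
by rewrite (ln_powR V) (ln_powR sigma) (ln_powR t) lnL ln_powR lnA lnVn; field.
Qed.

(** Rounding up at most doubles [A] when [m > 1], so the two logarithmic factors
    of the rates, at [A] and at [mup], are comparable. *)
Let V_bounds : mup != minn M n -> (1 < m)%N -> U <= V <= 2 * U.
Proof.
move=> /effective_dimension_sparse[/andP[_ mm] _ Amup mupA _] m1.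
have mup2 : 2 <= mup%:R :> R by rewrite (ler_nat _ 2) (leq_trans m1).
have Mpos : 0 < M%:R :> R by rewrite ltr0n (leq_trans _ M2).
have mup0 : 0 < mup%:R :> R by lra.
have h1 : ln A <= ln mup%:R by rewrite ler_ln ?posrE.
have h2 : ln mup%:R <= ln 2 + ln A.
  by rewrite -lnM ?posrE// ler_ln ?posrE ?mulr_gt0//; lra.
have h3 : ln 2 <= 1 :> R.
  by have := @le_ln1Dx R 1; rewrite (_ : 1 + 1 = 2)//; apply; lra.
have := U1; rewrite /V /U !ln_div ?posrE//; lra.
Qed.

Let ln_V_le : mup != minn M n -> (1 < m)%N -> ln V <= ln 2 + ln U.
Proof.
move=> mupF m1; have /andP[V1 V2] := V_bounds mupF m1.
have := U1 => U1'.
by rewrite -lnM ?posrE// ler_ln ?posrE ?mulr_gt0//; lra.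
Qed.

Let rate_full : mup = minn M n ->
  rate_lq n M r sigma q t <= noise_level * m%:R.
Proof.
move=> /effective_dimension_full[mE _].
rewrite /rate_lq -/m mE eqxx mulrAC -noise_level_def ler_wpM2l ?(ltW noise_level0)//.
by rewrite ler_nat.
Qed.

Let rate_sparse : mup != minn M n ->
  rate_lq n M r sigma q t <= if (1 < m)%N then sparse_rate else t ^+ 2.
Proof.
move=> /effective_dimension_sparse[/andP[_ mm] lt_mup _ _ _].
rewrite /rate_lq -/m -W_def -A_def -/V -/sparse_rate.
rewrite (_ : (m == _) = false); last by rewrite ltn_eqF// (leq_ltn_trans mm).
by case: ifP => _; rewrite ge_min lexx.
Qed.

(** The largest lambda allowed by the l_q constraint with K blocks has
    lambda^2 = t^2 K^(-2/q), so the right-hand side is K lambda^2.  As 2/q >= 1 it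
    decreases in K, which reduces the claim to K = m; in units of the noise level
    it reads m (A / m)^(2/q).  The upper bounds for [m] in terms of [A] and the
    logarithmic factor finish the proof, after taking logarithms. *)
Lemma rate_le_radius (K : nat) : (0 < K <= m)%N ->
  c * rate_lq n M r sigma q t <= K%:R * (t ^+ 2 * K%:R `^ (- (2 / q))).
Proof.
move=> /andP[K0 Km].
have K0' : 0 < K%:R :> R by rewrite ltr0n.
have t20 : 0 < t ^+ 2 by rewrite exprn_gt0.
have Kp : 0 < K%:R `^ (- (2 / q)) by exact: powR_gt0.
have mp : 0 < m%:R `^ (- (2 / q)) by exact: powR_gt0.
have q2 : 2 <= 2 / q by rewrite ler_pdivlMr//; case/andP: q01; lra.
have lnmK : ln K%:R <= ln m%:R :> R by rewrite ler_ln ?posrE// ler_nat.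
apply: (@le_trans _ _ (m%:R * (t ^+ 2 * m%:R `^ (- (2 / q))))); last first.
  rewrite -ler_ln ?posrE ?mulr_gt0// !lnM ?posrE ?mulr_gt0//.
  rewrite (ln_powR K%:R) (ln_powR m%:R).
  nra.
have [mupF|mupF] := eqVneq mup (minn M n).
  have [_ mA] := effective_dimension_full mupF.
  apply: le_trans (ler_wpM2l (ltW c0) (rate_full mupF)) _.
  rewrite sq_radius (mulrCA c) -(mulrA noise_level) (mulrCA m%:R).
  rewrite ler_wpM2l ?(ltW noise_level0)//.
  rewrite -ler_ln ?posrE ?mulr_gt0// !lnM ?posrE ?mulr_gt0//.
  rewrite (ln_powR 4) (ln_powR m%:R) lnW.
  have : ln m%:R <= ln 4 + ln A.
    by rewrite -lnM ?posrE// ler_ln ?posrE ?mulr_gt0//; have := A0; lra.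
  nra.
apply: le_trans (ler_wpM2l (ltW c0) (rate_sparse mupF)) _.
have [mm lt_mup Amup mupA /andP[mupm mmup]] := effective_dimension_sparse mupF.
have Y0 : 0 < U `^ (q / 2) by exact: powR_gt0.
case: ifPn => [m1|m1]; last first.
  have -> : m = 1%N by apply/eqP; rewrite eqn_leq leqNgt m1 eff_lower_gt0.
  rewrite powR1 mul1r mulr1 ler_piMl ?(ltW t20)//; have := rate_constant_le; lra.
have /andP[V1 V2] := V_bounds mupF m1.
have V0 : 0 < V by apply: lt_le_trans V1.
have lnVU := ln_V_le mupF m1.
have Vp : 0 < V `^ (1 - q / 2) by exact: powR_gt0.
rewrite sparse_rateE// sq_radius (mulrCA c) -(mulrA noise_level) (mulrCA m%:R).
rewrite ler_wpM2l ?(ltW noise_level0)//.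
rewrite -ler_ln ?posrE ?mulr_gt0// !lnM ?posrE ?mulr_gt0//.
rewrite (ln_powR 4) (ln_powR V) (ln_powR m%:R) lnW.
have ln4 : ln 4 = 2 * ln 2 :> R.
  by rewrite (_ : 4 = 2 ^+ 2 :> R) ?lnXn ?mulr_natl//; ring.
have m2 : 2 <= m%:R :> R by rewrite (ler_nat _ 2).
have lnm : ln m%:R + q / 2 * ln U <= ln 4 + ln A.
  rewrite -(ln_powR U) -!lnM ?posrE// ler_ln ?posrE ?mulr_gt0//.
  have : mup%:R <= 2 * A.
    have : m%:R <= mup%:R :> R by rewrite ler_nat; case/andP: mm.
    by lra.
  nra.
rewrite ln4 in lnm *.
have ln2 := @ln2_ge_half R.
(* With p = 2 / q, multiply the bound for ln m by p - 1, and use that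
   (p - 1) q / 2 = 1 - q / 2 is the exponent of the logarithmic factor. *)
have q2i : q / 2 * (2 / q) = 1 by field; rewrite gt_eqF.
move: lnm lnVU; set a := ln A; set u := ln U; set v := ln V; set b := ln 2.
set p := 2 / q => lnm lnVU.
have h1 : (p - 1) * (ln m%:R + q / 2 * u) <= (p - 1) * (2 * b + a).
  by rewrite ler_wpM2l//; move: q2; rewrite /p; lra.
have h2 : (1 - q / 2) * v <= (1 - q / 2) * (b + u).
  by rewrite ler_wpM2l//; case/andP: q01; lra.
have h3 : (p - 1) * (q / 2 * u) = (1 - q / 2) * u.
  by rewrite mulrA mulrBl [p * _]mulrC q2i mul1r.
have b0 : 0 <= b by move: ln2; rewrite -/b; lra.
have h4 : 0 <= q / 2 * b by rewrite mulr_ge0 ?divr_ge0 ?(ltW q0).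
by move: h1; rewrite mulrDr h3; lra.
Qed.

(** When the noise limits lambda, m blocks give the squared error of order
    m (1 + ln (M / m)) sigma^2 / n.  The lower bounds for [m] in terms of [A] are
    what is needed here; for [m = 1] they say that the squared radius itself is
    below this order. *)
Lemma rate_le_dimension :
  c * rate_lq n M r sigma q t <=
  m%:R * (sigma ^+ 2 * (1 + ln (M%:R / m%:R)) / (6 * n%:R)).
Proof.
have Mpos : 0 < M%:R :> R by rewrite ltr0n (leq_trans _ M2).
have mM : m%:R <= M%:R :> R.
  by rewrite ler_nat (leq_trans eff_lower_le)// geq_minl.
have -> : sigma ^+ 2 * (1 + ln (M%:R / m%:R)) / (6 * n%:R) =
    noise_level * ((1 + ln (M%:R / m%:R)) / 6).
  by rewrite noise_level_def; field; rewrite gt_eqF.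
have c16 := rate_constant_le; have cpos := c0; have Lpos := noise_level0.
have [mupF|mupF] := eqVneq mup (minn M n).
  apply: le_trans (ler_wpM2l (ltW c0) (rate_full mupF)) _.
  rewrite mulrCA [leRHS]mulrCA ler_wpM2l ?(ltW noise_level0)//.
  rewrite mulrC ler_wpM2l ?(ltW m0)//.
  have : 0 <= ln (M%:R / m%:R) :> R by rewrite ln_ge0// ler_pdivlMr// mul1r.
  lra.
apply: le_trans (ler_wpM2l (ltW c0) (rate_sparse mupF)) _.
have [/andP[_ mm] lt_mup Amup mupA /andP[mupm mmup]] := effective_dimension_sparse mupF.
have mup0 : 0 < mup%:R :> R by rewrite ltr0n.
have Y0 : 0 < U `^ (q / 2) by exact: powR_gt0.
have lnA : ln A <= ln m%:R + q / 2 * ln U.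
  by rewrite -(ln_powR U) -lnM ?posrE// ler_ln ?posrE ?mulr_gt0//; lra.
have Um : U <= 1 + ln (M%:R / m%:R).
  have : ln m%:R <= ln mup%:R :> R by rewrite ler_ln ?posrE// ler_nat.
  by rewrite /U !ln_div ?posrE//; lra.
case: ifPn => [m1|m1]; last first.
  have mE : m = 1%N by apply/eqP; rewrite eqn_leq leqNgt m1 eff_lower_gt0.
  have WU : W <= U.
    rewrite -ler_ln ?posrE// lnW; move: lnA; rewrite mE ln1 add0r => lnA.
    rewrite mulrC -ler_pdivlMr ?divr_gt0// (le_trans lnA)// le_eqVlt.
    by apply/orP; left; apply/eqP; field; rewrite gt_eqF.
  move: Um; rewrite mE mul1r sq_radius mulrCA ler_pM2l// => Um.
  have := W0; nra.
have /andP[V1 V2] := V_bounds mupF m1.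
have V0 : 0 < V by apply: lt_le_trans V1.
have lnVU := ln_V_le mupF m1.
have Vp : 0 < V `^ (1 - q / 2) by exact: powR_gt0.
have AV : A * V `^ (1 - q / 2) <= 2 * m%:R * U.
  rewrite -ler_ln ?posrE ?mulr_gt0// !lnM ?posrE ?mulr_gt0// (ln_powR V).
  have h2 : (1 - q / 2) * ln V <= (1 - q / 2) * (ln 2 + ln U).
    by rewrite ler_wpM2l//; case/andP: q01; lra.
  have h4 : 0 <= q / 2 * ln 2.
    by rewrite mulr_ge0 ?divr_ge0 ?(ltW q0)//; have := @ln2_ge_half R; lra.
  lra.
rewrite sparse_rateE// mulrCA [leRHS]mulrCA ler_pM2l//.
have mU0 : 0 < m%:R * U by rewrite mulr_gt0.
apply: (@le_trans _ _ (m%:R * U / 8)).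
  have : c * (A * V `^ (1 - q / 2)) <= 1 / 16 * (2 * m%:R * U).
    by apply: ler_pM => //; rewrite ltW// mulr_gt0.
  lra.
apply: (@le_trans _ _ (m%:R * U / 6)); first lra.
by rewrite -mulrA ler_pM2l//; lra.
Qed.

Lemma rate_lq_le : rate_lq n M r sigma q t <= sigma ^+ 2 * r%:R / n%:R.
Proof.
by rewrite /rate_lq; case: ifP => // _; case: ifP => _; rewrite ge_min lexx orbT.
Qed.

End rates.

(** * The three minimax lower bounds *)

Section minimax.
Context {R : realType} {d : measure_display} {T : measurableType d}.
Context (P : probability T R) {n M : nat} (X : 'M[R]_(n, M)).
Context (eps : 'I_n -> {RV P >-> R}) (sigma alow aup : R).
Hypotheses (n2 : (2 <= n)%N) (M2 : (2 <= M)%N) (s0 : 0 < sigma) (a0 : 0 < alow).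
Hypotheses (nd : normalized_design X) (iid : iid_gaussian sigma eps).

Let n0 : 0 < n%:R :> R. Proof. by rewrite ltr0n (leq_trans _ n2). Qed.

Lemma sparse_rate_ge0 (k : nat) : (1 <= k <= M)%N ->
  0 <= sigma ^+ 2 * (1 + ln (M%:R / k%:R)) / (6 * n%:R).
Proof.
move=> /andP[k1 kM]; apply: divr_ge0; last by rewrite mulr_ge0// ltW.
rewrite mulr_ge0 ?sqr_ge0// addr_ge0// ln_ge0//.
by rewrite ler_pdivlMr ?ltr0n// mul1r ler_nat.
Qed.

(** [block_risk] with blocks of maximal size M %/ k; [ln_block_size] makes the
    constraint on lambda explicit, with 6 = 2 * 3. *)
Lemma sparse_risk (k : nat) (lambda : R) (F : set ('cV[R]_M -> R)) :
  (1 <= k <= M)%N -> SRC' X k%:R alow aup -> 0 <= lambda ->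
  lambda ^+ 2 <= sigma ^+ 2 * (1 + ln (M%:R / k%:R)) / (6 * n%:R) ->
  (forall theta, (l0norm theta <= k)%N ->
    (forall q, 0 < q -> lqnorm q theta <= lambda * k%:R `^ q^-1) ->
    F (lin_fct theta)) ->
  ((alow ^+ 2 / 32 * (lambda ^+ 2 * k%:R))%:E <= minimax_risk X eps F)%E.
Proof.
move=> k1M src l0 lle HF; have /andP[k1 kM] := k1M.
have ksM : (k * (M %/ k) <= M)%N by rewrite mulnC leq_trunc_div.
apply: (block_risk (ksM := ksM) s0 _ _ a0 iid nd src) => //.
- by rewrite (leq_trans _ n2).
- by rewrite divn_gt0.
- apply: le_trans lle _; rewrite ler_pdivrMr ?mulr_gt0//.
  have -> : sigma ^+ 2 * ln (M %/ k).+1%:R / (2 * n%:R) * (6 * n%:R) =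
      sigma ^+ 2 * (3 * ln (M %/ k).+1%:R).
    by field; rewrite gt_eqF.
  rewrite ler_pM2l ?exprn_gt0//; have := @ln_block_size R _ _ k1M; lra.
- move=> J; apply: HF; first exact: l0norm_block_vector.
  by move=> q q0; exact: lqnorm_block_vector.
Qed.

Lemma l0_minimax (k : nat) : (1 <= k <= M)%N -> SRC' X k%:R alow aup ->
  ((alow ^+ 2 / 192 * rate_l0 n M (\rank X) sigma k)%:E <=
   minimax_risk X eps (l0_hull M k))%E.
Proof.
move=> k1M src; have /andP[k1 kM] := k1M.
have k0 : 0 < k%:R :> R by rewrite ltr0n.
pose v := sigma ^+ 2 * (1 + ln (M%:R / k%:R)) / (6 * n%:R).
have v0 : 0 <= v by exact: sparse_rate_ge0.
have /le_trans : ((alow ^+ 2 / 192 * rate_l0 n M (\rank X) sigma k)%:E <=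
    (alow ^+ 2 / 32 * (Num.sqrt v ^+ 2 * k%:R))%:E)%E; last apply.
  rewrite lee_fin sqr_sqrtr// -mulrA -(mulrA _ 32^-1) ler_pM2l ?exprn_gt0//.
  apply: (@le_trans _ _
      (192^-1 * (sigma ^+ 2 * k%:R * (1 + ln (M%:R / k%:R)) / n%:R))).
    by rewrite ler_pM2l// /rate_l0 ge_min lexx.
  by rewrite le_eqVlt; apply/orP; left; apply/eqP; rewrite /v; field; rewrite gt_eqF.
apply: (sparse_risk k1M src); rewrite ?sqrtr_ge0//.
  by rewrite sqr_sqrtr.
by move=> theta th _; exists theta.
Qed.

(** Use K = min (k, m) blocks and the largest lambda allowed.  If the l_q radius is
    the active constraint, [rate_le_radius] compares with the l_q rate.  If the
    noise is, compare with the l_0 rate when K = k, and with the l_q rate by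
    [rate_le_dimension] when K = m. *)
Lemma lq_l0_minimax (q t : R) (k : nat) : 0 < q <= 1 -> 0 < t ->
  (1 <= k <= M)%N -> SRC' X (minn k (eff_lower n M sigma q t))%:R alow aup ->
  ((alow ^+ 2 / 32 * 4 `^ (- (2 / q)) *
      rate_lq_l0 n M (\rank X) sigma q t k)%:E <=
   minimax_risk X eps (lq_hull M q t `&` l0_hull M k))%E.
Proof.
move=> q01 t0 /andP[k1 kM]; set m := eff_lower _ _ _ _ _; set K := minn k m => src.
have /andP[q0 q1] := q01.
have m1 : (0 < m)%N by exact: (eff_lower_gt0 n2 M2 s0 t0 q01 erefl erefl).
have mMn : (m <= minn M n)%N.
  by exact: (eff_lower_le n2 M2 s0 t0 q01 erefl erefl).
have K1 : (0 < K)%N by rewrite leq_min k1.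
have KM : (K <= M)%N by rewrite (leq_trans (geq_minl _ _)).
have Km : (K <= m)%N by exact: geq_minr.
have K0 : 0 < K%:R :> R by rewrite ltr0n.
have rMn : (\rank X <= minn M n)%N by rewrite leq_min rank_leq_col rank_leq_row.
have radius := rate_le_radius n2 M2 s0 t0 q01 erefl erefl erefl rMn.
have dimension := rate_le_dimension n2 M2 s0 t0 q01 erefl erefl erefl rMn.
set c := 4 `^ _ in radius dimension *.
have c0 : 0 < c by exact: powR_gt0.
have c6 : c <= 6^-1 by have := rate_constant_le q01; rewrite -/c; lra.
pose v := sigma ^+ 2 * (1 + ln (M%:R / K%:R)) / (6 * n%:R).
have v0 : 0 <= v by apply: sparse_rate_ge0; rewrite K1.
pose u := t * K%:R `^ (- q^-1).
have u0 : 0 < u by rewrite mulr_gt0// powR_gt0.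
have u2 : u ^+ 2 = t ^+ 2 * K%:R `^ (- (2 / q)).
  rewrite /u exprMn -(powR_mulrn 2 (powR_ge0 _ _)) -powRrM; congr (_ * _ `^ _).
  by field; rewrite gt_eqF.
pose lambda := Num.min u (Num.sqrt v).
have l0 : 0 <= lambda by rewrite le_min (ltW u0) sqrtr_ge0.
have lv : lambda ^+ 2 <= v.
  rewrite -[leRHS]sqr_sqrtr// ler_sqr ?nnegrE ?sqrtr_ge0//.
  by rewrite ge_min lexx orbT.
have K1M : (1 <= K <= M)%N by rewrite K1.
have rate : c * rate_lq_l0 n M (\rank X) sigma q t k <= lambda ^+ 2 * K%:R.
  have lq : c * rate_lq_l0 n M (\rank X) sigma q t k <=
      c * rate_lq n M (\rank X) sigma q t.
    by rewrite ler_pM2l// /rate_lq_l0 ge_min lexx.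
  rewrite /lambda; case: (leP u (Num.sqrt v)) => _.
    by rewrite u2 [leRHS]mulrC; apply: le_trans lq (radius _ _); rewrite K1.
  rewrite sqr_sqrtr// [leRHS]mulrC; have [km|mk] := leqP k m; last first.
    by rewrite /v /K (minn_idPr (ltnW mk)); exact: le_trans lq dimension.
  rewrite /v /K (minn_idPl km).
  have k0 : 0 < k%:R :> R by rewrite ltr0n.
  have lnk : 0 <= ln (M%:R / k%:R) :> R.
    by rewrite ln_ge0// ler_pdivlMr// mul1r ler_nat.
  pose z := sigma ^+ 2 * k%:R * (1 + ln (M%:R / k%:R)) / n%:R.
  have z0 : 0 <= z.
    rewrite /z divr_ge0 ?(ltW n0)//; apply: mulr_ge0; last exact: addr_ge0.
    by rewrite mulr_ge0 ?sqr_ge0.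
  apply: (@le_trans _ _ (c * z)).
    rewrite ler_pM2l// /rate_lq_l0 ge_min; apply/orP; right.
    by rewrite /rate_l0 ge_min lexx.
  apply: (@le_trans _ _ (6^-1 * z)); first by rewrite ler_wpM2r.
  by rewrite le_eqVlt; apply/orP; left; apply/eqP; rewrite /z; field; rewrite gt_eqF.
apply: (@le_trans _ _ (alow ^+ 2 / 32 * (lambda ^+ 2 * K%:R))%:E).
  by rewrite lee_fin -mulrA ler_pM2l// divr_gt0// exprn_gt0.
apply: (sparse_risk K1M src l0 lv) => theta th0 thq; split; exists theta => //=.
  apply: le_trans (thq q q0) _.
  apply: (@le_trans _ _ (u * K%:R `^ q^-1)).
    by rewrite ler_wpM2r ?powR_ge0// ge_min lexx.
  rewrite /u -mulrA -powRD; last by rewrite (gt_eqF K0) implybT.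
  by rewrite addNr powRr0 mulr1.
by rewrite (leq_trans th0)// geq_minl.
Qed.

(** The case k = M of the intersection: the l_0 ball is then everything, and the
    l_0 rate is sigma^2 rank / n, which bounds the l_q rate anyway. *)
Lemma lq_minimax (q t : R) : 0 < q <= 1 -> 0 < t ->
  SRC' X (eff_lower n M sigma q t)%:R alow aup ->
  ((alow ^+ 2 / 32 * 4 `^ (- (2 / q)) * rate_lq n M (\rank X) sigma q t)%:E <=
   minimax_risk X eps (lq_hull M q t))%E.
Proof.
move=> q01 t0 src.
have mM : (eff_lower n M sigma q t <= M)%N.
  have := eff_lower_le n2 M2 s0 t0 q01 erefl erefl.
  by rewrite leq_min => /andP[].
have -> : lq_hull M q t = lq_hull M q t `&` l0_hull M M.
  apply/esym/setIidl => _ [theta _ <-]; exists theta => //=.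
  by rewrite (leq_trans (max_card _))// card_ord.
have -> : rate_lq n M (\rank X) sigma q t =
    rate_lq_l0 n M (\rank X) sigma q t M.
  have Mpos : 0 < M%:R :> R by rewrite ltr0n (leq_trans _ M2).
  rewrite /rate_lq_l0 /rate_l0 divff ?gt_eqF// ln1 addr0 mulr1.
  apply/esym/min_idPl; rewrite le_min andbC rate_lq_le/=.
  apply: le_trans (rate_lq_le _ _ _ _ _ _) _.
  rewrite ler_pM2r ?invr_gt0// ler_pM2l ?exprn_gt0// ler_nat.
  exact: rank_leq_col.
apply: lq_l0_minimax => //; first by rewrite (leq_trans _ M2)/=.
by rewrite (minn_idPr mM).
Qed.

End minimax.

Theorem theorem8 (R : realType) :
  (forall q alow aup : R, 0 < q <= 1 -> 0 < alow -> 0 < aup ->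
    exists B : R, 0 < B /\
    forall (n M : nat) (X : 'M[R]_(n, M)) (sigma t : R)
      (d : measure_display) (T : measurableType d) (P : probability T R)
      (eps : 'I_n -> {RV P >-> R}),
      (2 <= n)%N -> (2 <= M)%N -> 0 < sigma -> 0 < t ->
      normalized_design X -> (1 <= \rank X)%N ->
      iid_gaussian sigma eps ->
      SRC' X (eff_lower n M sigma q t)%:R alow aup ->
      ((B * rate_lq n M (\rank X) sigma q t)%:E <=
       minimax_risk X eps (lq_hull M q t))%E)
  /\
  (forall alow aup : R, 0 < alow -> 0 < aup ->
    exists B : R, 0 < B /\
    forall (n M : nat) (X : 'M[R]_(n, M)) (sigma : R) (k : nat)
      (d : measure_display) (T : measurableType d) (P : probability T R)
      (eps : 'I_n -> {RV P >-> R}),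
      (2 <= n)%N -> (2 <= M)%N -> 0 < sigma -> (1 <= k <= M)%N ->
      normalized_design X -> (1 <= \rank X)%N ->
      iid_gaussian sigma eps ->
      SRC' X k%:R alow aup ->
      ((B * rate_l0 n M (\rank X) sigma k)%:E <=
       minimax_risk X eps (l0_hull M k))%E)
  /\
  (forall q alow aup : R, 0 < q <= 1 -> 0 < alow -> 0 < aup ->
    exists B : R, 0 < B /\
    forall (n M : nat) (X : 'M[R]_(n, M)) (sigma t : R) (k : nat)
      (d : measure_display) (T : measurableType d) (P : probability T R)
      (eps : 'I_n -> {RV P >-> R}),
      (2 <= n)%N -> (2 <= M)%N -> 0 < sigma -> 0 < t -> (1 <= k <= M)%N ->
      normalized_design X -> (1 <= \rank X)%N ->
      iid_gaussian sigma eps ->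
      SRC' X (minn k (eff_lower n M sigma q t))%:R alow aup ->
      ((B * rate_lq_l0 n M (\rank X) sigma q t k)%:E <=
       minimax_risk X eps (lq_hull M q t `&` l0_hull M k))%E).
Proof.
have B_lq (q alow : R) : 0 < alow -> 0 < alow ^+ 2 / 32 * 4 `^ (- (2 / q)).
  by move=> a0; rewrite mulr_gt0 ?powR_gt0// divr_gt0// exprn_gt0.
split; last split.
- move=> q alow aup q01 a0 _; eexists; split; first exact: (B_lq q _ a0).
  move=> n M X sigma t d T P eps n2 M2 s0 t0 nd _ iid src.
  exact: lq_minimax src.
- move=> alow aup a0 _; exists (alow ^+ 2 / 192); split.
    by rewrite divr_gt0// exprn_gt0.
  move=> n M X sigma k d T P eps n2 M2 s0 kM nd _ iid src.
  exact: l0_minimax src.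
- move=> q alow aup q01 a0 _; eexists; split; first exact: (B_lq q _ a0).
  move=> n M X sigma t k d T P eps n2 M2 s0 t0 kM nd _ iid src.
  exact: lq_l0_minimax src.
Qed.
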